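(* Let $\omega,\gamma\in\mathbb{R}$ and let $u_0\in H^4(\mathbb{R})$. Let $u=u(t,x)$ be the solution, with lifespan $T>0$, of the Cauchy problem $$m_t+2\omega u_x+um_x+2u_xm=-\gamma u_{xxx}\quad (t>0,\ x\in\mathbb{R}),\qquad u(0,x)=u_0(x)\quad (x\in\mathbb{R}),$$ where $m:=u-u_{xx}$. The following statements are equivalent: 1. For each $t\in[0,T)$, the function $x\mapsto u(t,x)+\omega+\gamma/2$ has compact support. 2. $u\equiv 0$ and $\omega+\gamma/2=0$. 3. There exists a non-empty open set $\Omega\subseteq[0,T)\times\mathbb{R}$ such that $u(t,x)=0$ for all $(t,x)\in\Omega$, and $\omega+\gamma/2=0$.
   Context: The equation is the Dullin-Gottwald-Holm (DGH) equation (with parameter $\alpha=1$). For $u_0\in H^s(\mathbb{R})$, $s>3/2$, the Cauchy problem is known to have a unique solution $u\in C^0([0,T);H^s(\mathbb{R}))\cap C^1([0,T);H^{s-1}(\mathbb{R}))$ with a maximal existence time $T>0$, called its lifespan; ''the solution corresponding to $u_0$'' means this one. *)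

(* Defs.v *)
From mathcomp Require Import all_boot all_order all_algebra.
From mathcomp Require Import all_classical all_reals all_analysis.

Set Implicit Arguments.
Unset Strict Implicit.
Unset Printing Implicit Defensive.

Import Order.TTheory GRing.Theory Num.Theory.
Import numFieldNormedType.Exports.

Local Open Scope classical_set_scope.
Local Open Scope ring_scope.

Definition has_compact_support (R : realType) (f : R -> R) : Prop :=
  compact (closure [set x | f x != 0]).

Definition test_function (R : realType) (phi : R -> R) : Prop :=
  (forall n x, derivable (derive1n n phi) x 1) /\ has_compact_support phi.

Definition L2 (R : realType) : set (R -> R) :=
  [set f | f \in Lfun (@lebesgue_measure R) 2%:E].

Definition weak_derivative (R : realType) (j : nat) (f g : R -> R) : Prop :=
  forall phi : R -> R, test_function phi ->
    \int[@lebesgue_measure R]_x (f x * derive1n j phi x) =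
    (-1) ^+ j * \int[@lebesgue_measure R]_x (g x * phi x).

Definition sobolev (R : realType) (k : nat) : set (R -> R) :=
  [set f | L2 f /\
    forall j, (j <= k)%N -> exists2 g, L2 g & weak_derivative j f g].

(* Junk value 0 when [f] has no square-integrable weak derivative of order [j];
   otherwise determined up to a null set. *)
Definition wderiv (R : realType) (j : nat) (f : R -> R) : R -> R :=
  xget (cst 0) [set g | L2 g /\ weak_derivative j f g].

(* Meaningful only for [f] in [sobolev k]. *)
Definition sobolev_norm (R : realType) (k : nat) (f : R -> R) : \bar R :=
  ((\sum_(j < k.+1)
      ('N[@lebesgue_measure R]_(2%:E)[EFin \o wderiv j f] ^+ 2)) `^ 2^-1)%E.

Definition lifetime (R : realType) (T : \bar R) : set R :=
  [set t | 0 <= t /\ (t%:E < T)%E].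

(* v belongs to C^0([0,T); H^k) *)
Definition C0_sobolev (R : realType) (T : \bar R) (k : nat) (v : R -> R -> R) :
    Prop :=
  forall t, lifetime T t ->
    sobolev k (v t) /\
    sobolev_norm k (fun x => v s x - v t x)
      @[s --> within (lifetime T) (nbhs t)] --> 0%E.

(* v belongs to C^1([0,T); H^k); the derivative at t = 0 is one-sided. *)
Definition C1_sobolev (R : realType) (T : \bar R) (k : nat) (v : R -> R -> R) :
    Prop :=
  C0_sobolev T k v /\
  exists2 v' : R -> R -> R, C0_sobolev T k v' &
    forall t, lifetime T t ->
      sobolev_norm k (fun x => (v s x - v t x) / (s - t) - v' t x)
        @[s --> within (lifetime T) (dnbhs t)] --> 0%E.

Definition momentum (R : realType) (u : R -> R -> R) (t x : R) : R :=
  u t x - derive1n 2 (u t) x.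

(* The first two clauses only exclude junk values of the derivatives. For the
   solutions below they are automatic: H^4 embeds in C^3, and u - u_xx is a
   C^1 curve in H^1, which embeds in C^0. *)
Definition dgh_equation (R : realType) (omega gamma : R) (u : R -> R -> R) (t x : R) :
    Prop :=
  let m := momentum u in
  [/\ forall j, (j < 3)%N -> derivable (derive1n j (u t)) x 1,
      derivable (fun s => m s x) t 1
    & derive1 (fun s => m s x) t + 2 * omega * derive1 (u t) x
        + u t x * derive1 (m t) x + 2 * derive1 (u t) x * m t x
      = - gamma * derive1n 3 (u t) x].

(* Elements of H^4 are classes modulo null sets: u t is the continuous
   representative, and the initial condition is an equality of classes. *)
Definition dgh_solution (R : realType) (omega gamma : R) (u0 : R -> R) (T : \bar R)
    (u : R -> R -> R) : Prop :=
  [/\ (0 < T)%E,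
      C0_sobolev T 4 u /\ C1_sobolev T 3 u,
      forall t, lifetime T t -> continuous (u t),
      {ae @lebesgue_measure R, forall x, u 0 x = u0 x}
    & forall t x, 0 < t -> (t%:E < T)%E -> dgh_equation omega gamma u t x].

Definition dgh_maximal_solution (R : realType) (omega gamma : R) (u0 : R -> R)
    (T : \bar R) (u : R -> R -> R) : Prop :=
  dgh_solution omega gamma u0 T u /\
  forall T' v, dgh_solution omega gamma u0 T' v -> (T' <= T)%E.

(* Main.v *)
(* When omega + gamma/2 = 0 the equation reads m_t = - F' with
   F = (u - gamma) m + (u^2 - u_x^2)/2, and F' is (1 - d_x^2) of
   (u - gamma) u_x plus d_x of f = u^2 + u_x^2/2.  If u vanishes on a rectangle
   (t - d, t + d) x (a, b), then at time t integrating against exp(-x) from a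
   point y of (a, b) to infinity leaves the integral of exp(-x) f, which is
   therefore zero; reflecting in x, u(t, .) = 0.  Next, m solves a linear
   transport equation with bounded coefficients, so a maximum principle for
   m^2 exp(-l s)/(1 + x^2) propagates u(t, .) = 0 to nearby times, and
   connectedness of (0, T) to all times.  If every u(t, .) has compact support,
   Baire's theorem gives a common support on some time interval, hence such a
   rectangle.  Sobolev norms are converted to sup norms by testing weak
   derivatives against explicit bump functions. *)
Require Import Defs.
From mathcomp Require Import all_boot all_order all_algebra.
From mathcomp Require Import all_classical all_reals all_analysis.
From mathcomp Require Import measurable_realfun ring lra.

Set Implicit Arguments.
Unset Strict Implicit.
Unset Printing Implicit Defensive.

Import Order.TTheory GRing.Theory Num.Theory.
Import numFieldNormedType.Exports.

Local Open Scope classical_set_scope.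
Local Open Scope ring_scope.

(** * Smooth step function *)

(** The obstacle is regularity. Only the momentum [u - u_xx] is given a pointwise time derivative;
    [u] itself is differentiable in time only in [H^3], where the derivative is a class without
    usable pointwise values, and [u_xxx] is merely the derivative of [u_xx], not known to be
    continuous. Hence the integration against exp(-x) becomes the monotonicity of an explicit
    primitive, obtained from the mean value theorem, and [u_t] becomes a difference quotient at one
    nearby time. The price is a uniform error [e] in the identity at time [t]. It is harmless
    because the argument is quantitative: if [u(t, .)] were nonzero somewhere, [f] would raise the
    primitive by a fixed positive amount, known before [e] is chosen. For the transport equation,
    the maximum principle stands in for characteristics because it asks only for bounds, joint
    continuity of [m] and separate derivatives in [t] and [x]. *)

Lemma is_derive1_eq (R : realType) (f : R -> R) (x a b : R) :
  is_derive x 1 f a -> a = b -> is_derive x 1 f b.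
Proof. by move=> fa <-. Qed.

Lemma is_derive1D (R : realType) (f g : R -> R) (x a b : R) :
  is_derive x 1 f a -> is_derive x 1 g b ->
  is_derive x 1 (fun y => f y + g y) (a + b).
Proof. exact: is_deriveD. Qed.

Lemma is_derive1B (R : realType) (f g : R -> R) (x a b : R) :
  is_derive x 1 f a -> is_derive x 1 g b ->
  is_derive x 1 (fun y => f y - g y) (a - b).
Proof. exact: is_deriveB. Qed.

Lemma is_derive1N (R : realType) (f : R -> R) (x a : R) :
  is_derive x 1 f a -> is_derive x 1 (fun y => - f y) (- a).
Proof. exact: is_deriveN. Qed.

Lemma is_derive1M (R : realType) (f g : R -> R) (x a b : R) :
  is_derive x 1 f a -> is_derive x 1 g b ->
  is_derive x 1 (fun y => f y * g y) (a * g x + f x * b).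
Proof.
move=> fa gb.
have h : is_derive x 1 (f * g) (f x *: b + g x *: a) by exact: is_deriveM.
have -> : a * g x + f x * b = f x *: b + g x *: a.
  by rewrite /GRing.scale/= addrC [a * _]mulrC.
exact: h.
Qed.

Lemma is_derive1Ml (R : realType) (f : R -> R) (c x a : R) :
  is_derive x 1 f a -> is_derive x 1 (fun y => c * f y) (c * a).
Proof. exact: is_deriveZ. Qed.

Lemma is_derive1Mr (R : realType) (f : R -> R) (c x a : R) :
  is_derive x 1 f a -> is_derive x 1 (fun y => f y * c) (a * c).
Proof.
move=> fa; rewrite mulrC; have -> : (fun y => f y * c) = (fun y => c * f y).
  by apply/funext => y; rewrite mulrC.
exact: is_derive1Ml.
Qed.

Lemma is_derive1V (R : realType) (f : R -> R) (x a : R) : f x != 0 ->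
  is_derive x 1 f a -> is_derive x 1 (fun y => (f y)^-1) (- (a / f x ^+ 2)).
Proof.
move=> f0 fa.
have h : is_derive x 1 (fun y => (f y)^-1) (- (f x) ^- 2 *: a).
  exact: is_deriveV.
have -> : - (a / f x ^+ 2) = - (f x) ^- 2 *: a.
  by rewrite /GRing.scale/= mulNr mulrC.
exact: h.
Qed.

Lemma is_derive1_affine (R : realType) (f : R -> R) (c d x a : R) :
  is_derive (c * x + d) 1 f a -> is_derive x 1 (fun y => f (c * y + d)) (c * a).
Proof.
move=> fa; rewrite mulrC.
have h : is_derive x 1 (fun y => c * y + d) c.
  have := is_derive1D (is_derive1Ml c (is_derive_id x 1)) (is_derive_cst d x 1).
  by rewrite mulr1 addr0.
exact: (@is_derive1_comp _ f _ x a c).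
Qed.

Lemma is_derive1_continuous (R : realType) (f : R -> R) (x a : R) :
  is_derive x 1 f a -> {for x, continuous f}.
Proof. by move=> [/derivable1_diffP/differentiable_continuous]. Qed.

Lemma is_derive1E (R : realType) (f g : R -> R) :
  (forall x : R, is_derive x 1 f (g x)) -> derive1 f = g.
Proof. by move=> fg; apply/funext => x; rewrite derive1E; case: (fg x). Qed.

Lemma derivable1_is_derive (R : realType) (f : R -> R) (x : R) :
  derivable f x 1 -> is_derive x 1 f (derive1 f x).
Proof. by move=> ?; split; rewrite ?derive1E. Qed.

(** Derivatives are peeled from the inside, so that closure under sums, products and inverses goes
    by induction on [n] for all functions at once; [smoothP] returns to [derive1n]. *)
Fixpoint derivable_upto (R : realType) (n : nat) (f : R -> R) : Prop :=
  if n is n'.+1 then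
    (forall x : R, derivable f x 1) /\ derivable_upto n' (derive1 f)
  else True.

Definition smooth (R : realType) (f : R -> R) :=
  forall n (x : R), derivable (derive1n n f) x 1.

Lemma smoothP (R : realType) (f : R -> R) :
  smooth f <-> forall n, derivable_upto n f.
Proof.
split=> [sf n|sf n x].
  elim: n f sf => // n IH f sf; split; first exact: (sf 0%N).
  by apply: IH => k x; rewrite -derive1Sn; exact: sf.
have := sf n.+1; elim: n f {sf} => [|n IH] f /= [fd sf]; first exact: fd.
by rewrite -derive1nS derive1Sn; apply: IH.
Qed.

Lemma derivable_uptoS (R : realType) n (f g : R -> R) :
  (forall x : R, is_derive x 1 f (g x)) -> derivable_upto n g ->
  derivable_upto n.+1 f.
Proof.
by move=> fg gn; split=> [x|]; [case: (fg x)|rewrite (is_derive1E fg)].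
Qed.

Lemma derivable_uptoSP (R : realType) n (f : R -> R) :
  derivable_upto n.+1 f ->
  (forall x : R, is_derive x 1 f (derive1 f x)) /\ derivable_upto n (derive1 f).
Proof. by move=> [fd fn]; split=> // x; exact: derivable1_is_derive. Qed.

Lemma derivable_uptoW (R : realType) n (f : R -> R) :
  derivable_upto n.+1 f -> derivable_upto n f.
Proof. by elim: n f => // n IH f [fd /IH]. Qed.

Lemma derivable_uptoC (R : realType) n (c : R) : derivable_upto n (fun=> c : R).
Proof.
elim: n c => // n IH c; apply: derivable_uptoS (IH 0) => x; exact: is_derive_cst.
Qed.

Lemma derivable_uptoD (R : realType) n (f g : R -> R) :
  derivable_upto n f -> derivable_upto n g ->
  derivable_upto n (fun x => f x + g x).
Proof.
elim: n f g => // n IH f g /derivable_uptoSP[fd fn] /derivable_uptoSP[gd gn].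
by apply: derivable_uptoS (IH _ _ fn gn) => x; exact: is_derive1D.
Qed.

Lemma derivable_uptoM (R : realType) n (f g : R -> R) :
  derivable_upto n f -> derivable_upto n g ->
  derivable_upto n (fun x => f x * g x).
Proof.
elim: n f g => // n IH f g /[dup] /derivable_uptoW f0 /derivable_uptoSP[fd fn].
move=> /[dup] /derivable_uptoW g0 /derivable_uptoSP[gd gn].
apply: derivable_uptoS (derivable_uptoD (IH _ _ fn g0) (IH _ _ f0 gn)) => x.
exact: is_derive1M.
Qed.

Lemma derivable_uptoZ (R : realType) n (c : R) (f : R -> R) :
  derivable_upto n f -> derivable_upto n (fun x => c * f x).
Proof. by apply: derivable_uptoM; exact: derivable_uptoC. Qed.

Lemma derivable_uptoV (R : realType) n (f : R -> R) : (forall x, f x != 0) ->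
  derivable_upto n f -> derivable_upto n (fun x => (f x)^-1).
Proof.
move=> f0; elim: n => // n IH /[dup] /derivable_uptoW fn /derivable_uptoSP[fd f'n].
have := IH fn => IHn.
have h (x : R) : is_derive x 1 (fun x => (f x)^-1)
    (-1 * (derive1 f x * ((f x)^-1 * (f x)^-1))).
  apply: (is_derive1_eq (is_derive1V (f0 x) (fd x))).
  by rewrite mulN1r -expr2 exprVn.
apply: derivable_uptoS h _.
apply: derivable_uptoZ; apply: derivable_uptoM => //; exact: derivable_uptoM.
Qed.

Lemma derivable_upto_affine (R : realType) n (f : R -> R) (c d : R) :
  derivable_upto n f -> derivable_upto n (fun x => f (c * x + d)).
Proof.
elim: n f => // n IH f /derivable_uptoSP[fd fn].
apply: derivable_uptoS (derivable_uptoZ c (IH _ fn)) => x.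
exact: is_derive1_affine.
Qed.

Lemma exp_is_derive (R : realType) n (x : R) :
  is_derive x 1 (fun y => y ^+ n) (n%:R * x ^+ n.-1).
Proof.
split; first exact: exprn_derivable.
by rewrite exp_derive /GRing.scale/= mulr1.
Qed.

(** The flat function exp(-1/x) divided by [x^n]. The span of this family is stable under
    differentiation, so smoothness is proved for all its members simultaneously. *)
Definition flat_exp (R : realType) (n : nat) (x : R) : R :=
  if 0 < x then x ^- n * expR (- x^-1) else 0.

Lemma flat_exp_ge0 (R : realType) n (x : R) : 0 <= flat_exp n x.
Proof.
rewrite /flat_exp; case: ifP => // x0.
by rewrite mulr_ge0 ?expR_ge0// invr_ge0 exprn_ge0// ltW.
Qed.

Lemma flat_expS (R : realType) n (x : R) :
  flat_exp n x = flat_exp n.+1 x * x.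
Proof.
rewrite /flat_exp; case: ifP => [x0|]; last by rewrite mul0r.
by rewrite exprS invfM [RHS]mulrAC [_ * _ * x]mulrAC mulVf ?gt_eqF// mul1r.
Qed.

(** Comes from [exp y >= y^(n+1) / (n+1)!] at [y = 1/x]. *)
Lemma flat_exp_le (R : realType) n (x : R) :
  `|flat_exp n x| <= n.+1`!%:R * `|x|.
Proof.
rewrite ger0_norm ?flat_exp_ge0// /flat_exp; case: ifP => [x0|]; last by rewrite mulr_ge0.
rewrite (gtr0_norm x0) expRN ler_pdivrMr ?expR_gt0//.
have := @expR_ge1Dxn R x^-1 n; rewrite invr_ge0 ltW// => /(_ isT) h.
have fp : (0 : R) < n.+1`!%:R by rewrite ltr0n fact_gt0.
rewrite -mulrA -ler_pdivrMl// mulrC -ler_pdivrMl//.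
apply: le_trans h; rewrite -[leLHS]add0r; apply: lerD => //.
by rewrite mulrA exprS exprVn.
Qed.

Lemma is_derive_flat_exp (R : realType) n (x : R) :
  is_derive x 1 (@flat_exp R n) (flat_exp n.+2 x - n%:R * flat_exp n.+1 x).
Proof.
have [x0|x0|->] := ltgtP x 0; last first.
- have -> : flat_exp n.+2 (0 : R) - n%:R * flat_exp n.+1 0 = 0.
    by rewrite /flat_exp ltxx mulr0 subr0.
  (* By [flat_expS] the difference quotient of [flat_exp n] at 0 is [flat_exp n.+1]; its continuity
     at 0 is [flat_exp_le]. *)
  apply/is_derive1_caratheodory; exists (@flat_exp R n.+1); split.
  + by move=> z; rewrite {2}/flat_exp ltxx !subr0 flat_expS.
  + have E0 : flat_exp n.+1 (0 : R) = 0 by rewrite /flat_exp ltxx.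
    suff : flat_exp n.+1 z @[z --> (0 : R)] --> flat_exp n.+1 (0 : R) by [].
    rewrite E0; apply/cvgr0Pnorm_lt => e e0.
    set c : R := n.+2`!%:R; have c0 : 0 < c by rewrite ltr0n fact_gt0.
    near=> z; apply: le_lt_trans (flat_exp_le _ _) _.
    rewrite -/c -ltr_pdivlMl//.
    near: z; exists (c^-1 * e); first by rewrite /= mulr_gt0// invr_gt0.
    by move=> z /=; rewrite sub0r normrN.
  + by rewrite /flat_exp ltxx.
- apply: (@near_eq_is_derive R R R (fun y => (y ^+ n)^-1 * expR (-1 * y^-1))).
    near=> y; rewrite /flat_exp ifT ?mulN1r//.
    by near: y; exact: lt_nbhsr.
  have xn0 : x != 0 by rewrite gt_eqF.
  have dV := @is_derive1V R (fun y => y ^+ n) x _ (expf_neq0 n xn0) (exp_is_derive n x).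
  have dE := is_derive1_comp (is_derive_expR _)
    (is_derive1Ml (-1) (@is_derive1V R id x _ xn0 (is_derive_id x 1))).
  apply: (is_derive1_eq (is_derive1M dV dE)).
  rewrite /flat_exp x0 /GRing.scale/= !mulN1r.
  move: (expR (- x^-1)) => E {dV dE}; case: n => [|n].
    by rewrite !mul0r !oppr0; field.
  rewrite /= !exprS expr0 mulr1; move: (n.+1%:R) => k.
  move: (expf_neq0 n xn0); move: (x ^+ n) => y yn0.
  by field; rewrite xn0 yn0.
- have flat0 k (y : R) : y < 0 -> flat_exp k y = 0.
    by move=> y0; rewrite /flat_exp ifF//; apply/negbTE; rewrite -leNgt ltW.
  apply: (@near_eq_is_derive R R R (fun=> 0)).
    near=> y; rewrite flat0//; near: y; exact: lt_nbhsl.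
  by rewrite !flat0// mulr0 subr0; exact: is_derive_cst.
Unshelve. all: by end_near. Qed.

Lemma derivable_upto_flat_exp (R : realType) n k :
  derivable_upto n (@flat_exp R k).
Proof.
elim: n k => // n IH k.
have h (x : R) : is_derive x 1 (@flat_exp R k)
    (flat_exp k.+2 x + (- k%:R) * flat_exp k.+1 x).
  by rewrite mulNr; exact: is_derive_flat_exp.
apply: derivable_uptoS h _.
apply: derivable_uptoD => //; exact: derivable_uptoZ.
Qed.

Definition smooth_step (R : realType) (x : R) : R :=
  flat_exp 0 x / (flat_exp 0 x + flat_exp 0 (1 - x)).

Lemma flat_exp_gt0 (R : realType) n (x : R) : 0 < x -> 0 < flat_exp n x.
Proof.
by move=> x0; rewrite /flat_exp x0 mulr_gt0 ?expR_gt0// invr_gt0 exprn_gt0.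
Qed.

Lemma flat_exp_le0 (R : realType) n (x : R) : x <= 0 -> flat_exp n x = 0.
Proof. by move=> x0; rewrite /flat_exp ltNge x0. Qed.

Lemma smooth_step_den (R : realType) (x : R) :
  0 < flat_exp 0 x + flat_exp 0 (1 - x).
Proof.
have [x0|x0] := leP x 0.
  by rewrite ltr_wpDl ?flat_exp_ge0// flat_exp_gt0//; lra.
by rewrite ltr_wpDr ?flat_exp_ge0// flat_exp_gt0.
Qed.

Lemma smooth_step_le0 (R : realType) (x : R) : x <= 0 -> smooth_step x = 0.
Proof. by move=> x0; rewrite /smooth_step flat_exp_le0// mul0r. Qed.

Lemma smooth_step_ge1 (R : realType) (x : R) : 1 <= x -> smooth_step x = 1.
Proof.
move=> x1; rewrite /smooth_step (@flat_exp_le0 _ _ (1 - x)); last by lra.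
by rewrite addr0 divff// gt_eqF// flat_exp_gt0; lra.
Qed.

Lemma smooth_step_itv (R : realType) (x : R) : 0 <= smooth_step x <= 1.
Proof.
rewrite /smooth_step divr_ge0 ?flat_exp_ge0 ?(ltW (smooth_step_den _))//=.
by rewrite ler_pdivrMr ?smooth_step_den// mul1r lerDl flat_exp_ge0.
Qed.

Lemma smooth_smooth_step (R : realType) n : derivable_upto n (@smooth_step R).
Proof.
have h := @derivable_upto_flat_exp R n 0.
apply: derivable_uptoM => //.
apply: derivable_uptoV => [x|]; first by rewrite gt_eqF// smooth_step_den.
apply: derivable_uptoD => //.
have -> : (fun x : R => flat_exp 0 (1 - x)) = (fun x : R => flat_exp 0 (-1 * x + 1)).
  by apply/funext => x; rewrite mulN1r addrC.
exact: derivable_upto_affine.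
Qed.

(** * Test functions *)

Lemma has_compact_support_itv (R : realType) (f : R -> R) (a b : R) :
  (forall x, ~~ (a <= x <= b) -> f x = 0) -> has_compact_support f.
Proof.
move=> f0; apply: (subclosed_compact _ (@segment_compact R a b)).
  exact: closed_closure.
move: (@itv_closed _ R a b); rewrite closure_id => ->.
apply: closureS => x /= fx; rewrite in_itv/=.
by apply: contraNT fx => /f0 ->.
Qed.

Lemma has_compact_support_bounded (R : realType) (f : R -> R) :
  has_compact_support f -> exists2 N : R, 0 < N & forall x, N < `|x| -> f x = 0.
Proof.
move=> /compact_bounded[M [_ hM]].
exists (`|M| + 1) => [|x Nx]; first by rewrite ltr_wpDl.
apply/eqP; apply: contraTT Nx => fx; rewrite -leNgt.
apply: hM; last exact: subset_closure.
by rewrite (le_lt_trans (ler_norm M))// ltrDl.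
Qed.

Lemma continuous_supp_integral (R : realType) (f : R -> R) (a b : R) :
  continuous f -> (forall x, ~~ (a <= x <= b) -> f x = 0) ->
  (@lebesgue_measure R).-integrable setT (EFin \o f) /\
  \int[@lebesgue_measure R]_x f x = \int[@lebesgue_measure R]_(x in `[a, b]) f x.
Proof.
move=> cf f0.
have E : (EFin \o f) \_ `[a, b] = EFin \o f.
  apply/funext => x; rewrite /patch; case: ifPn => //= /negP xab.
  rewrite f0//; apply/negP => h; apply: xab.
  by rewrite inE /= in_itv.
split.
  rewrite -E; apply: (integrable_mkcond _ _).1 => //.
  apply: continuous_compact_integrable; first exact: segment_compact.
  exact: continuous_subspaceT.
by rewrite /Rintegral [in RHS]integral_mkcond; congr (fine (integral _ _ _)).
Qed.

Lemma derivable_LRcontinuous (R : realType) (f f' : R -> R) (a b : R) :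
  (forall x : R, is_derive x 1 f (f' x)) -> derivable_oo_LRcontinuous f a b.
Proof.
move=> fd; split=> [x _||]; first by case: (fd x).
- by apply: cvg_at_right_filter; exact: is_derive1_continuous (fd a).
- by apply: cvg_at_left_filter; exact: is_derive1_continuous (fd b).
Qed.

Lemma test_function_zero (R : realType) (phi : R -> R) : test_function phi ->
  exists2 N : R, 0 < N & forall x, N <= `|x| -> phi x = 0 /\ derive1 phi x = 0.
Proof.
move=> [sphi /has_compact_support_bounded[N N0 phi0]].
(* The margin 1 leaves a whole neighbourhood of [x] where [phi] vanishes, hence a zero
   derivative. *)
exists (N + 1) => [|x Nx]; first by rewrite ltr_wpDl// ltW.
have phiN : \forall y \near x, 0 = phi y.
  near=> y; rewrite phi0//.
  have : `|x - y| < 1 by near: y; exact: cvgr_dist_lt.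
  have := ler_normD y (x - y); rewrite addrC subrK; lra.
split; first by have := nbhs_singleton phiN.
have := @near_eq_is_derive _ R R (fun=> 0) phi x 1 0 phiN (is_derive_cst _ _ _).
by rewrite derive1E => -[].
Unshelve. all: by end_near. Qed.

Lemma test_function_derive (R : realType) (phi : R -> R) :
  test_function phi -> test_function (derive1 phi).
Proof.
move=> tphi; split; first by move=> n x; rewrite -derive1Sn; apply: (tphi.1).
have [N N0 phi0] := test_function_zero tphi.
apply: (@has_compact_support_itv _ _ (- N) N) => x.
by rewrite -ler_norml -ltNge => /ltW/phi0[].
Qed.

Lemma test_function_continuous (R : realType) (phi : R -> R) :
  test_function phi -> continuous phi.
Proof.
by move=> tphi x; have /derivable1_is_derive/is_derive1_continuous := tphi.1 0%N x.
Qed.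

Lemma test_function_by_parts (R : realType) (f f' phi : R -> R) :
  (forall x : R, is_derive x 1 f (f' x)) -> continuous f' -> test_function phi ->
  \int[@lebesgue_measure R]_x (f x * derive1 phi x) =
  - \int[@lebesgue_measure R]_x (f' x * phi x).
Proof.
move=> fd cf' tphi; have [N N0 phi0] := test_function_zero tphi.
have cf : continuous f by move=> x; exact: is_derive1_continuous (fd x).
have cphi := test_function_continuous tphi.
have cphi' := test_function_continuous (test_function_derive tphi).
have z (g h : R -> R) (x : R) : (N <= `|x| -> h x = 0) -> ~~ (- N <= x <= N) -> g x * h x = 0.
  by rewrite -ler_norml -ltNge => h0 /ltW/h0 ->; rewrite mulr0.
rewrite (@continuous_supp_integral R _ (- N) N _ _).2; last 2 first.
  by move=> x; apply: continuousM; [exact: cf|exact: cphi'].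
  by move=> x; apply: z => /phi0[].
rewrite (@continuous_supp_integral R _ (- N) N _ _).2; last 2 first.
  by move=> x; apply: continuousM; [exact: cf'|exact: cphi].
  by move=> x; apply: z => /phi0[].
rewrite (@Rintegration_by_parts R f phi f').
- have [-> _] : phi N = 0 /\ derive1 phi N = 0 by apply: phi0; rewrite ler_norm.
  have [-> _] : phi (- N) = 0 /\ derive1 phi (- N) = 0.
    by apply: phi0; rewrite normrN ler_norm.
  by rewrite !mulr0 subrr sub0r.
- by rewrite gtrN.
- exact: continuous_subspaceT.
- exact: derivable_LRcontinuous fd.
- by move=> x _; rewrite derive1E; case: (fd x).
- exact: continuous_subspaceT.
- apply: (@derivable_LRcontinuous _ _ (derive1 phi)) => x.
  by apply: derivable1_is_derive; exact: (tphi.1 0%N).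
- by [].
Qed.

(** * A sup bound from weak derivatives *)

Definition L2norm (R : realType) (f : R -> R) : R :=
  fine 'N[@lebesgue_measure R]_(2%:E)[EFin \o f].

Lemma L2normE (R : realType) (f : R -> R) : L2 f ->
  'N[@lebesgue_measure R]_(2%:E)[EFin \o f]%E = (L2norm f)%:E.
Proof.
move=> /andP[_]; rewrite inE /= => Nh.
by rewrite /L2norm fineK// ge0_fin_numE// Lnorm_ge0.
Qed.

Lemma L2norm_ge0 (R : realType) (f : R -> R) : 0 <= L2norm f.
Proof. by rewrite fine_ge0// Lnorm_ge0. Qed.

(** The support has length one, so the sup bound passes to the L2 norm with constant 1. *)
Lemma L2_bounded_supp (R : realType) (f : R -> R) (x K : R) : 0 <= K ->
  continuous f -> (forall y, `|f y| <= K) ->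
  (forall y, ~~ (x <= y <= x + 1) -> f y = 0) ->
  L2 f /\ L2norm f <= K.
Proof.
move=> K0 cf fK f0; have mf := continuous_measurable_fun cf.
have N2 : ('N[@lebesgue_measure R]_(2%:E)[EFin \o f] <= K%:E)%E.
  have E : (K%:E = (K ^+ 2)%:E `^ 2^-1)%E.
    by rewrite poweR_EFin -powR_mulrn// -powRrM mulfV// powRr1.
  rewrite E unlock /=.
  have le : (\int[@lebesgue_measure R]_y (`|(EFin \o f) y| `^ 2%R) <= (K ^+ 2)%:E)%E.
    have -> : (K ^+ 2)%:E =
        (\int[@lebesgue_measure R]_(y in `[x, (x + 1)%R]) (cst (K ^+ 2)%:E) y)%E.
      have := @lebesgue_measure_itv R `[x, (x + 1)].
      rewrite /= lte_fin ltrDl ltr01 -EFinD addrAC subrr add0r => m1.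
      by rewrite integral_cst// [X in (_ * X)%E]m1 mule1.
    rewrite [leRHS]integral_mkcond; apply: ge0_le_integral => //.
    - by move=> y _; rewrite poweR_ge0.
    - apply/measurable_EFinP.
      apply/(@measurableT_comp _ _ _ _ _ _ (fun x : R => x `^ 2)%R) => //.
      exact/measurableT_comp.
    - by apply/measurable_restrict => //; exact: measurable_cst.
    - move=> y _; rewrite /patch; case: ifPn => [_|].
        rewrite /= lee_fin powR_mulrn// ler_pXn2r// nnegrE//.
      rewrite notin_setE/= in_itv/= => /negP/f0 -> /=.
      by rewrite normr0 powR0.
  apply: (@gt0_ler_poweR R 2^-1 _ _ _ _ _ le) => //; rewrite in_itv/= leey andbT.
    by apply: integral_ge0 => y _; rewrite lee_fin powR_ge0.
  by rewrite lee_fin sqr_ge0.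
have Lf : L2 f.
  rewrite /L2/= inE; apply/andP; split; rewrite inE//=.
  exact: le_lt_trans N2 (ltry _).
by split=> //; rewrite -lee_fin -L2normE.
Qed.

Lemma L2_pairing (R : realType) (g f : R -> R) : L2 g -> L2 f ->
  (@lebesgue_measure R).-integrable setT (EFin \o (fun x => g x * f x)) /\
  `|\int[@lebesgue_measure R]_x (g x * f x)| <= L2norm g * L2norm f.
Proof.
move=> Lg Lf.
have I : (@lebesgue_measure R).-integrable setT (EFin \o (fun x => g x * f x)).
  by apply/Lfun1_integrable; exact: Lfun2_mul_Lfun1.
split=> //; rewrite -lee_fin EFinM -!L2normE// EFin_normr_Rintegral//.
apply: le_trans (le_abse_integral _ _ _) _ => //.
  exact: measurable_int I.
move: Lg Lf => /andP[/[!inE]/= mg _] /andP[/[!inE]/= mf _].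
apply: le_trans; last first.
  by apply: (@hoelder _ _ _ (@lebesgue_measure R) g f 2 2) => //; lra.
by rewrite Lnorm1.
Qed.

(** [1 <= M] lets the same constant also bound differences of two steps, whose values lie in
    [[-1, 1]]. *)
Lemma smooth_step_derive_bound (R : realType) :
  exists2 M : R, 1 <= M & forall x, `|derive1 (@smooth_step R) x| <= M.
Proof.
have ct : continuous (derive1 (@smooth_step R)).
  move=> x; have [fd _] := derivable_uptoSP (@smooth_smooth_step R 2).
  have [_ /derivable_uptoSP[fd' _]] := derivable_uptoSP (@smooth_smooth_step R 2).
  exact: is_derive1_continuous (fd' x).
have [|c _ hc] := @EVT_max R (fun x => `|derive1 (@smooth_step R) x|) 0 1 ler01.
  apply: continuous_subspaceT => x.
  by apply: cvg_norm; exact: ct.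
exists (1 + `|derive1 (@smooth_step R) c|) => [|x]; first by rewrite lerDl.
have [xin|/negP xout] := boolP (0 <= x <= 1).
  by rewrite (le_trans (hc x _)) ?in_itv// ler_wpDl.
suff -> : derive1 (@smooth_step R) x = 0 by rewrite normr0 addr_ge0.
have h : exists c : R, \forall y \near x, c = smooth_step y.
  have [x0|x0] := ltP x 0.
    exists 0; near=> y; rewrite smooth_step_le0//.
    by apply: ltW; near: y; exact: lt_nbhsl.
  have x1 : 1 < x by rewrite ltNge; apply/negP => x1; apply: xout; rewrite x0.
  exists 1; near=> y; rewrite smooth_step_ge1//.
  by apply: ltW; near: y; exact: lt_nbhsr.
case: h => k h.
have := @near_eq_is_derive R R R (fun=> k) (@smooth_step R) x 1 0 h
  (is_derive_cst _ _ _).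
by rewrite derive1E => -[].
Unshelve. all: by end_near. Qed.

(** * Approximate delta functions *)

Definition scaled_step (R : realType) (e x y : R) : R :=
  smooth_step (e^-1 * y + - (e^-1 * x)).

(** A one-sided approximate delta on [[x, x + e]]. As the derivative of a step it has mass 1 by the
    fundamental theorem, and two such bumps of different scales differ by the derivative of a
    compactly supported function. The argument [(y - x) / e] is spelled as an affine map to suit
    [is_derive1_affine]. *)
Definition scaled_bump (R : realType) (e x y : R) : R :=
  e^-1 * derive1 (@smooth_step R) (e^-1 * y + - (e^-1 * x)).

Section scaled_bump.
Variables (R : realType) (x e : R).
Hypothesis e0 : 0 < e.

Lemma is_derive_scaled_step (y : R) :
  is_derive y 1 (scaled_step e x) (scaled_bump e x y).
Proof.
apply: is_derive1_affine.
by have [fd _] := derivable_uptoSP (@smooth_smooth_step R 1); exact: fd.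
Qed.

Lemma scaled_step_le (y : R) : y <= x -> scaled_step e x y = 0.
Proof.
move=> yx; apply: smooth_step_le0; rewrite -mulrBr.
by rewrite pmulr_rle0 ?invr_gt0// subr_le0.
Qed.

Lemma scaled_step_ge (y : R) : x + e <= y -> scaled_step e x y = 1.
Proof.
move=> yx; apply: smooth_step_ge1; rewrite -mulrBr.
by rewrite ler_pdivlMl// mulr1 lerBrDl.
Qed.

Lemma smooth_scaled_step : smooth (scaled_step e x).
Proof.
apply/smoothP => n; apply: derivable_upto_affine; exact: smooth_smooth_step.
Qed.

Lemma scaled_bump_supp y : ~~ (x <= y <= x + e) -> scaled_bump e x y = 0.
Proof.
move=> yout.
have h : exists c : R, \forall z \near y, c = scaled_step e x z.
  have [yx|xy] := ltP y x.
    exists 0; near=> z; rewrite scaled_step_le//.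
    by apply: ltW; near: z; exact: lt_nbhsl.
  have xy' : x + e < y by rewrite ltNge; apply/negP => h; move: yout; rewrite xy h.
  exists 1; near=> z; rewrite scaled_step_ge//.
  by apply: ltW; near: z; exact: lt_nbhsr.
case: h => k h.
have [_ E1] := @near_eq_is_derive R R R (fun=> k) _ y 1 0 h (is_derive_cst _ _ _).
by have [_ E2] := is_derive_scaled_step y; rewrite -E2.
Unshelve. all: by end_near. Qed.

Lemma test_function_scaled_bump : test_function (scaled_bump e x).
Proof.
split; last exact: has_compact_support_itv scaled_bump_supp.
move=> n y; rewrite -(is_derive1E is_derive_scaled_step) -derive1Sn.
exact: smooth_scaled_step.
Qed.

Lemma integral_scaled_bump : \int[@lebesgue_measure R]_y scaled_bump e x y = 1.
Proof.
have ct := test_function_continuous test_function_scaled_bump.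
rewrite (@continuous_supp_integral R _ x (x + e) ct scaled_bump_supp).2.
rewrite /Rintegral (@continuous_FTC2 R _ (scaled_step e x)).
- by rewrite scaled_step_ge// scaled_step_le//= subr0.
- by rewrite ltrDl.
- exact: continuous_subspaceT.
- exact: derivable_LRcontinuous is_derive_scaled_step.
- by move=> y _; rewrite (is_derive1E is_derive_scaled_step).
Qed.

End scaled_bump.

Lemma test_function_step_diff (R : realType) (e x : R) : 0 < e <= 1 ->
  test_function (fun y => scaled_step e x y - scaled_step 1 x y) /\
  (forall y, derive1 (fun y => scaled_step e x y - scaled_step 1 x y) y =
    scaled_bump e x y - scaled_bump 1 x y).
Proof.
move=> /andP[e0 e1]; split; last first.
  move=> y; rewrite derive1E.
  by have [_ ->] := is_derive1B (is_derive_scaled_step x e y) (is_derive_scaled_step x 1 y).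
split.
  suff : smooth (fun y => scaled_step e x y + (-1) * scaled_step 1 x y).
    by under eq_fun do rewrite mulN1r.
  have sm f : smooth (scaled_step f x) by exact: smooth_scaled_step.
  apply/smoothP => n; apply: derivable_uptoD; last apply: derivable_uptoZ;
    exact: (smoothP _).1 (sm _) n.
apply: (@has_compact_support_itv _ _ x (x + 1)) => y; rewrite negb_and -!ltNge.
move=> /orP[yx|xy].
  by rewrite !scaled_step_le ?subrr ?ltr01 ?ltW.
by rewrite !scaled_step_ge ?subrr ?ltr01//; lra.
Qed.

(** Writing [b] as [phi' + b1] pairs [g] with [b1] and [g'] with [phi]. The norm of [b], which blows
    up with the concentration of the bump, never enters. *)
Lemma weak_derivative_pairing_bound (R : realType)
    (k g g' phi b b1 : R -> R) (M : R) :
  L2 g -> L2 g' ->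
  \int[@lebesgue_measure R]_x (k x * b1 x) =
    \int[@lebesgue_measure R]_x (g x * b1 x) ->
  \int[@lebesgue_measure R]_x (k x * derive1 phi x) =
    - (\int[@lebesgue_measure R]_x (g' x * phi x)) ->
  (forall x, derive1 phi x = b x - b1 x) ->
  (@lebesgue_measure R).-integrable setT (EFin \o (fun x => k x * b x)) ->
  (@lebesgue_measure R).-integrable setT (EFin \o (fun x => k x * b1 x)) ->
  L2 b1 /\ L2norm b1 <= M -> L2 phi /\ L2norm phi <= M ->
  `|\int[@lebesgue_measure R]_x (k x * b x)| <= M * (L2norm g + L2norm g').
Proof.
move=> Lg Lg' kg kg' dphi ikb ikb1 [Lb1 b1M] [Lphi phiM].
have [_ pg] := L2_pairing Lg Lb1; have [_ pg'] := L2_pairing Lg' Lphi.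
move: kg'; under eq_Rintegral do rewrite dphi mulrBr.
rewrite RintegralB// kg => /eqP; rewrite subr_eq => /eqP ->.
rewrite addrC mulrDr; apply: le_trans (ler_normB _ _) _; apply: lerD.
  by rewrite (le_trans pg)// mulrC ler_wpM2r ?L2norm_ge0.
by rewrite (le_trans pg')// mulrC ler_wpM2r ?L2norm_ge0.
Qed.

Lemma integrable_scaled_bump (R : realType) (k : R -> R) (e x : R) : 0 < e ->
  continuous k -> (@lebesgue_measure R).-integrable setT
    (EFin \o (fun y => k y * scaled_bump e x y)).
Proof.
move=> e0 ck; apply: (@continuous_supp_integral R _ x (x + e) _ _).1.
  move=> y; apply: cvgM; first exact: ck.
  exact: test_function_continuous (test_function_scaled_bump x e0) _.
by move=> y yf; rewrite scaled_bump_supp// mulr0.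
Qed.

(** The bump is at most [M / e] in absolute value on an interval of length [e], hence the tolerance
    [d / M]. *)
Lemma scaled_bump_average (R : realType) (k : R -> R) (M d e x : R) :
  0 < M -> (forall x, `|derive1 (@smooth_step R) x| <= M) ->
  0 < e -> continuous k ->
  (forall y, x <= y <= x + e -> `|k y - k x| <= d / M) ->
  `|\int[@lebesgue_measure R]_y (k y * scaled_bump e x y) - k x| <= d.
Proof.
move=> M0 hM e0 ck ke.
have ikx : (@lebesgue_measure R).-integrable setT
    (EFin \o (fun y => k x * scaled_bump e x y)).
  by apply: integrable_scaled_bump => // y; exact: cvg_cst.
have i1 : (@lebesgue_measure R).-integrable setT (EFin \o scaled_bump e x).
  have -> : scaled_bump e x = (fun y => 1 * scaled_bump e x y).
    by apply/funext => y; rewrite mul1r.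
  by apply: integrable_scaled_bump => // y; exact: cvg_cst.
have -> : \int[@lebesgue_measure R]_y (k y * scaled_bump e x y) - k x =
    \int[@lebesgue_measure R]_y ((k y - k x) * scaled_bump e x y).
  under [RHS]eq_Rintegral do rewrite mulrBl.
  rewrite RintegralB//; last exact: integrable_scaled_bump.
  by rewrite RintegralZl// integral_scaled_bump// mulr1.
have cdiff : continuous (fun y => (k y - k x) * scaled_bump e x y).
  move=> y; apply: cvgM.
    by apply: cvgB; [exact: ck|exact: cvg_cst].
  exact: test_function_continuous (test_function_scaled_bump x e0) _.
have sdiff y : ~~ (x <= y <= x + e) -> (k y - k x) * scaled_bump e x y = 0.
  by move=> yf; rewrite scaled_bump_supp// mulr0.
have [_ ->] := continuous_supp_integral cdiff sdiff.
have idiff : (@lebesgue_measure R).-integrable `[x, x + e]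
    (EFin \o (fun y => (k y - k x) * scaled_bump e x y)).
  apply: continuous_compact_integrable; first exact: segment_compact.
  exact: continuous_subspaceT.
apply: le_trans (le_normr_Rintegral _ _) _ => //.
have -> : d = \int[@lebesgue_measure R]_(y in `[x, x + e]) (d / e).
  have := @lebesgue_measure_itv R `[x, (x + e)].
  rewrite /= lte_fin ltrDl e0 -EFinD addrAC subrr add0r => m1.
  by rewrite Rintegral_cst//= [X in fine X]m1/= divfK// gt_eqF.
apply: le_Rintegral => //.
- exact: integrable_norm.
- apply: continuous_compact_integrable; first exact: segment_compact.
  by apply: continuous_subspaceT => y; exact: cvg_cst.
- move=> y; rewrite /= in_itv/= => xye; rewrite normrM.
  have -> : d / e = (d / M) * (e^-1 * M) by field; rewrite !gt_eqF.
  apply: ler_pM => //; first exact: ke.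
  by rewrite /scaled_bump normrM gtr0_norm ?invr_gt0// ler_pM2l ?invr_gt0.
Qed.

(* The delta mass at [x] is approximated by [scaled_bump e x], which is
   [scaled_bump 1 x] plus the derivative of a test function bounded by 1. *)
Lemma weak_derivative_sup_bound (R : realType) :
  exists2 M : R, 0 < M & forall k g g' : R -> R, continuous k -> L2 g -> L2 g' ->
    (forall phi, test_function phi ->
      \int[@lebesgue_measure R]_x (k x * phi x) =
      \int[@lebesgue_measure R]_x (g x * phi x)) ->
    (forall phi, test_function phi ->
      \int[@lebesgue_measure R]_x (k x * derive1 phi x) =
      - (\int[@lebesgue_measure R]_x (g' x * phi x))) ->
    forall x, `|k x| <= M * (L2norm g + L2norm g').
Proof.
have [M M1 hM] := smooth_step_derive_bound R.
have M0 : 0 < M by exact: lt_le_trans M1.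
exists M => // k g g' ck Lg Lg' kg kg' x.
apply/ler_addgt0Pr => d d0.
have dM : 0 < d / M by rewrite divr_gt0.
have [e /andP[e0 e1] ke] : exists2 e : R, 0 < e <= 1 &
    forall y, x <= y <= x + e -> `|k y - k x| <= d / M.
  have /cvgrPdist_le/(_ _ dM) := ck x.
  move=> /nbhs_ballP[r /= r0 hr].
  (* The cap 1 keeps the difference of the two steps supported in [[x, x + 1]]. *)
  exists (Num.min (r / 2) 1) => [|y /andP[xy yx]].
    by rewrite lt_min ltr01 divr_gt0//= ge_min lexx orbT.
  rewrite distrC; apply: hr; rewrite /ball/= distrC ger0_norm ?subr_ge0//.
  rewrite ltrBlDl; apply: le_lt_trans yx _; rewrite ltrD2l gt_min.
  by rewrite ltr_pdivrMr// ltr_pMr// ltr1n.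
have av := scaled_bump_average M0 hM e0 ck ke.
have e01 : 0 < e <= 1 by rewrite e0.
have [tphi dphi] := test_function_step_diff x e01.
have tb1 := test_function_scaled_bump x (@ltr01 R).
have Lb1 : L2 (scaled_bump 1 x) /\ L2norm (scaled_bump 1 x) <= M.
  apply: (L2_bounded_supp (x := x)); first exact: ltW.
  - exact: test_function_continuous.
  - by move=> y; rewrite /scaled_bump invr1 mul1r; exact: hM.
  - by move=> y; exact: scaled_bump_supp.
have Lphi : L2 (fun y => scaled_step e x y - scaled_step 1 x y) /\
    L2norm (fun y => scaled_step e x y - scaled_step 1 x y) <= M.
  apply: (L2_bounded_supp (x := x)); first exact: ltW.
  - exact: test_function_continuous tphi.
  - move=> y; have /andP[? ?] := smooth_step_itv (e^-1 * y + - (e^-1 * x)).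
    have /andP[? ?] := smooth_step_itv (1^-1 * y + - (1^-1 * x)).
    apply: le_trans M1; rewrite ler_norml /scaled_step; apply/andP; split; lra.
  - move=> y; rewrite negb_and -!ltNge => /orP[yx|xy].
      by rewrite !scaled_step_le ?subrr ?ltr01 ?ltW.
    by rewrite !scaled_step_ge ?subrr ?ltr01//; lra.
have := weak_derivative_pairing_bound Lg Lg' (kg _ tb1) (kg' _ tphi) dphi
  (integrable_scaled_bump x e0 ck) (integrable_scaled_bump x ltr01 ck) Lb1 Lphi.
move: av; set J := \int[_]_y _ => JK JM.
have -> : k x = J - (J - k x) by ring.
by apply: le_trans (ler_normB _ _) _; exact: lerD.
Qed.

(** * Sobolev classes *)

Lemma L2_lin (R : realType) (f g : R -> R) (a b : R) : L2 f -> L2 g ->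
  L2 (fun x => a * f x + b * g x).
Proof.
move=> Lf Lg.
have p1 : (1%:E <= 2%:E :> \bar R)%E by rewrite lee_fin ler1n.
have Z (c : R) (h : R -> R) : L2 h -> L2 (fun x => c * h x).
  move=> Lh; have -> : (fun x => c * h x) = c \o* h.
    by apply/funext => x /=; rewrite mulrC.
  by apply: Lfun_scale => //; rewrite ler1n.
exact: (Lfun_addr_closed _ p1).2 (Z a f Lf) (Z b g Lg).
Qed.

Lemma L2B (R : realType) (f g : R -> R) : L2 f -> L2 g ->
  L2 (fun x => f x - g x).
Proof.
move=> Lf Lg; have := L2_lin 1 (-1) Lf Lg.
by congr L2; apply/funext => x; rewrite mul1r mulN1r.
Qed.

Lemma L2norm_triangle (R : realType) (f g : R -> R) : L2 f -> L2 g ->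
  L2norm (fun x => f x - g x) <= L2norm f + L2norm g.
Proof.
move=> Lf Lg; rewrite -lee_fin EFinD -!L2normE//; last exact: L2B.
move: Lf Lg => /andP[/[!inE]/= mf _] /andP[/[!inE]/= mg _].
have p1 : (1%:E <= 2%:E :> \bar R)%E by rewrite lee_fin ler1n.
have mNg : measurable_fun setT (\- g) by exact: measurableT_comp.
have := @eminkowski _ _ _ (@lebesgue_measure R) f (\- g) 2%:E mf mNg p1.
by rewrite -(@oppe_Lnorm _ _ _ (@lebesgue_measure R) (EFin \o g) 2%:E).
Qed.

Lemma test_function_L2 (R : realType) (phi : R -> R) : test_function phi -> L2 phi.
Proof.
move=> tphi; have cphi := test_function_continuous tphi.
have mphi := continuous_measurable_fun cphi.
have [N N0 phi0] := test_function_zero tphi.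
rewrite /L2/= inE; apply/andP; split; rewrite inE//=.
rewrite /finite_norm unlock poweR_lty//.
have c2 : continuous (fun x => phi x * phi x).
  by move=> x; apply: cvgM; exact: cphi.
have s2 x : ~~ (- N <= x <= N) -> phi x * phi x = 0.
  by rewrite -ler_norml -ltNge => /ltW/phi0[-> _]; rewrite mulr0.
have [/integrableP[_ +] _] := continuous_supp_integral c2 s2.
apply: le_lt_trans; apply: ge0_le_integral => //.
- by move=> x _; rewrite poweR_ge0.
- apply/measurable_EFinP.
  apply/(@measurableT_comp _ _ _ _ _ _ (fun x : R => x `^ 2)%R) => //.
  exact/measurableT_comp.
- apply/measurable_EFinP/measurableT_comp => //.
  exact: continuous_measurable_fun.
- by move=> x _ /=; rewrite lee_fin powR_mulrn// normrM expr2.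
Qed.

Lemma test_function_derive1n (R : realType) (phi : R -> R) n :
  test_function phi -> test_function (derive1n n phi).
Proof. by move=> tphi; elim: n => //= n; exact: test_function_derive. Qed.

Lemma integrable_L2_test (R : realType) (f phi : R -> R) n :
  L2 f -> test_function phi ->
  (@lebesgue_measure R).-integrable setT (EFin \o (fun x => f x * derive1n n phi x)).
Proof.
move=> Lf tphi.
by have [] := L2_pairing Lf (test_function_L2 (test_function_derive1n n tphi)).
Qed.

Lemma Rintegral_lin_mul (R : realType) (f g h : R -> R) (a b : R) :
  (@lebesgue_measure R).-integrable setT (EFin \o (fun x => f x * h x)) ->
  (@lebesgue_measure R).-integrable setT (EFin \o (fun x => g x * h x)) ->
  \int[@lebesgue_measure R]_x ((a * f x + b * g x) * h x) =
  a * (\int[@lebesgue_measure R]_x (f x * h x)) +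
  b * (\int[@lebesgue_measure R]_x (g x * h x)).
Proof.
move=> If Ig; under eq_Rintegral do rewrite mulrDl -!mulrA.
rewrite RintegralD//; first by rewrite !RintegralZl.
- exact: (@integrableZl _ _ _ _ _ measurableT a _ If).
- exact: (@integrableZl _ _ _ _ _ measurableT b _ Ig).
Qed.

Lemma weak_derivative_lin (R : realType) j (f g f' g' : R -> R) (a b : R) :
  L2 f -> L2 g -> L2 f' -> L2 g' ->
  weak_derivative j f f' -> weak_derivative j g g' ->
  weak_derivative j (fun x => a * f x + b * g x) (fun x => a * f' x + b * g' x).
Proof.
move=> Lf Lg Lf' Lg' wf wg phi tphi.
have I h n : L2 h -> _ := @integrable_L2_test R h phi n ^~ tphi.
rewrite !Rintegral_lin_mul; last 4 first.
- exact: (I f' 0%N). - exact: (I g' 0%N). - exact: I. - exact: I.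
by rewrite wf// wg//; ring.
Qed.

Lemma sobolev_wderiv (R : realType) k j (f : R -> R) : sobolev k f ->
  (j <= k)%N -> L2 (wderiv j f) /\ weak_derivative j f (wderiv j f).
Proof.
move=> [_ wf] jk; have [g Lg wg] := wf _ jk.
exact: (@xgetPex _ (cst 0) [set g | L2 g /\ weak_derivative j f g]
  (ex_intro _ g (conj Lg wg))).
Qed.

Lemma sobolev_lin (R : realType) k (f g : R -> R) (a b : R) :
  sobolev k f -> sobolev k g -> sobolev k (fun x => a * f x + b * g x).
Proof.
move=> [Lf wf] [Lg wg]; split; first exact: L2_lin.
move=> j jk; have [f' Lf' wf'] := wf _ jk; have [g' Lg' wg'] := wg _ jk.
exists (fun x => a * f' x + b * g' x); first exact: L2_lin.
exact: weak_derivative_lin.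
Qed.

Lemma wderiv_le_sobolev_norm (R : realType) k j (f : R -> R) : sobolev k f ->
  (j <= k)%N -> ((L2norm (wderiv j f))%:E <= sobolev_norm k f)%E.
Proof.
move=> sf jk; have [Lj _] := sobolev_wderiv sf jk.
have E : ((L2norm (wderiv j f))%:E = ((L2norm (wderiv j f)) ^+ 2)%:E `^ 2^-1)%E.
  by rewrite poweR_EFin -powR_mulrn ?L2norm_ge0// -powRrM mulfV// powRr1// L2norm_ge0.
rewrite E; apply: gt0_ler_poweR => //.
- by rewrite in_itv/= leey andbT lee_fin sqr_ge0.
- rewrite in_itv/= leey andbT; apply: sume_ge0 => i _.
  by apply: mule_ge0; exact: Lnorm_ge0.
rewrite -ltnS in jk.
rewrite (bigD1 (Ordinal jk))//= L2normE// EFin_expe leeDl//.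
apply: sume_ge0 => i _.
by apply: mule_ge0; exact: Lnorm_ge0.
Qed.

(** * Uniform convergence in space *)

(** This is the class C^j: the derivatives of order below [j] are continuous because they are
    differentiable. *)
Definition diff_upto (R : realType) (j : nat) (f : R -> R) : Prop :=
  (forall i (x : R), (i < j)%N -> derivable (derive1n i f) x 1) /\
  continuous (derive1n j f).

Lemma diff_uptoW (R : realType) i j (f : R -> R) : (i <= j)%N ->
  diff_upto j f -> diff_upto i f.
Proof.
move=> ij [df cf]; split=> [l x li|]; first exact: df (leq_trans li ij).
move: ij; rewrite leq_eqVlt => /predU1P[->//|ij] x.
exact: is_derive1_continuous (derivable1_is_derive (df _ x ij)).
Qed.

Lemma derive1n_lin (R : realType) j (f g : R -> R) (a b : R) :
  (forall i (x : R), (i < j)%N -> derivable (derive1n i f) x 1) ->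
  (forall i (x : R), (i < j)%N -> derivable (derive1n i g) x 1) ->
  derive1n j (fun x => a * f x + b * g x) =
  (fun x => a * derive1n j f x + b * derive1n j g x).
Proof.
elim: j => // j IH df dg; rewrite derive1nS IH; last 2 first.
- by move=> i x ij; exact: df (ltnW ij).
- by move=> i x ij; exact: dg (ltnW ij).
apply: is_derive1E => x.
by apply: is_derive1D; apply: is_derive1Ml; rewrite derive1nS;
  apply: derivable1_is_derive; [exact: df|exact: dg].
Qed.

Lemma diff_upto_lin (R : realType) j (f g : R -> R) (a b : R) :
  diff_upto j f -> diff_upto j g ->
  diff_upto j (fun x => a * f x + b * g x) /\
  derive1n j (fun x => a * f x + b * g x) =
  (fun x => a * derive1n j f x + b * derive1n j g x).
Proof.
move=> [df cf] [dg cg]; have E := derive1n_lin a b df dg.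
split; last exact: E.
split; last first.
  rewrite E => x; apply: cvgD; apply: cvgM; (try exact: cvg_cst);
    [exact: cf|exact: cg].
move=> i x ij; rewrite derive1n_lin; last 2 first.
- by move=> l y li; exact: df (ltn_trans li ij).
- by move=> l y li; exact: dg (ltn_trans li ij).
have h := is_derive1D (is_derive1Ml a (derivable1_is_derive (df i x ij)))
  (is_derive1Ml b (derivable1_is_derive (dg i x ij))).
by case: h.
Qed.

Lemma derive1n_by_parts (R : realType) j (f phi : R -> R) :
  diff_upto j f -> test_function phi ->
  \int[@lebesgue_measure R]_x (f x * derive1n j phi x) =
  (-1) ^+ j * \int[@lebesgue_measure R]_x (derive1n j f x * phi x).
Proof.
elim: j phi => [|j IH] phi; first by move=> _ _; rewrite mul1r.
move=> fj tphi; rewrite derive1Sn (IH _ (diff_uptoW (leqnSn j) fj)); last first.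
  exact: test_function_derive.
have fd (x : R) : is_derive x 1 (derive1n j f) (derive1n j.+1 f x).
  by rewrite derive1nS; apply: derivable1_is_derive; exact: fj.1.
by rewrite (test_function_by_parts fd fj.2 tphi) exprSr mulrN1 mulrN mulNr.
Qed.

(** The sup bound applied to the classical derivative of order [j]: integration by parts identifies
    it with [g], and its own weak derivative with [g'], the signs [(-1)^j] cancelling. Equality
    almost everywhere is never invoked, only equality against test functions. *)
Lemma sobolev_embedding (R : realType) :
  exists2 M : R, 0 < M & forall j (f g g' : R -> R), diff_upto j f ->
    L2 g -> L2 g' -> weak_derivative j f g -> weak_derivative j.+1 f g' ->
    forall x, `|derive1n j f x| <= M * (L2norm g + L2norm g').
Proof.
have [M M0 hM] := weak_derivative_sup_bound R; exists M => // j f g g' fj Lg Lg' wg wg'.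
apply: hM => // [|phi tphi|phi tphi]; first exact: fj.2.
  apply: (@mulrI _ ((-1) ^+ j)); first by rewrite unitrX// unitrN1.
  by rewrite -derive1n_by_parts// wg.
apply: (@mulrI _ ((-1) ^+ j)); first by rewrite unitrX// unitrN1.
rewrite -derive1n_by_parts//; last exact: test_function_derive.
by rewrite -derive1Sn wg'// exprSr mulrN1 !mulrN mulNr.
Qed.

Lemma within_ball (R : realType) (A : set R) (t : R) (P : R -> Prop) :
  (\forall s \near within A (nbhs t), P s) ->
  exists2 d, 0 < d & forall s, A s -> `|s - t| < d -> P s.
Proof.
rewrite near_withinE => /nbhs_ballP[d /= d0 hd]; exists d => // s As st.
by apply: hd => //; rewrite /ball/= distrC.
Qed.

Lemma within_dball (R : realType) (A : set R) (t : R) (P : R -> Prop) :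
  (\forall s \near within A (dnbhs t), P s) ->
  exists2 d, 0 < d & forall s, A s -> s != t -> `|s - t| < d -> P s.
Proof.
rewrite near_withinE => /nbhs_ballP[d /= d0 hd]; exists d => // s As st sd.
by apply: hd => //; rewrite /ball/= distrC.
Qed.

Lemma cvge0_near (R : realType) (F : set_system R) (f : R -> \bar R) (e : R) :
  f s @[s --> F] --> 0%E -> 0 < e -> \forall s \near F, (f s < e%:E)%E.
Proof.
move=> f0 e0; have /f0 : nbhs (0%E : \bar R) [set y | (y < e%:E)%E].
  by apply: open_ereal_lt'; rewrite lte_fin.
by [].
Qed.

Lemma sobolev_bounded (R : realType) k j (f : R -> R) : sobolev k f -> (j < k)%N ->
  diff_upto j f -> exists K, forall x, `|derive1n j f x| <= K.
Proof.
move=> sf jk fj; have [M _ hM] := sobolev_embedding R.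
have [Lg wg] := sobolev_wderiv sf (ltnW jk).
have [Lg' wg'] := sobolev_wderiv sf jk.
by exists (M * (L2norm (wderiv j f) + L2norm (wderiv j.+1 f))); exact: hM.
Qed.

(** The embedding uses weak derivatives of orders [j] and [j + 1], whence [j < k] and, for the two
    norms, the tolerance [e / (M * 2)]. *)
Lemma C0_sobolev_uniform (R : realType) (T : \bar R) k j (u : R -> R -> R) (t e : R) :
  C0_sobolev T k u -> (j < k)%N -> lifetime T t -> diff_upto j (u t) -> 0 < e ->
  exists2 d, 0 < d & forall s, lifetime T s -> `|s - t| < d -> diff_upto j (u s) ->
    forall x, `|derive1n j (u s) x - derive1n j (u t) x| <= e.
Proof.
move=> cu jk tT utj e0; have [M M0 hM] := sobolev_embedding R.
have [sut cut] := cu _ tT.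
have eM0 : 0 < e / (M * 2) by rewrite divr_gt0// mulr_gt0.
have /within_ball[d d0 hd] := cvge0_near cut eM0.
exists d => // s sT st usj x.
have [sus _] := cu _ sT.
have sust : sobolev k (fun x => u s x - u t x).
  have := sobolev_lin 1 (-1) sus sut.
  by congr sobolev; apply/funext => y; rewrite mul1r mulN1r.
have [Lg wg] := sobolev_wderiv sust (ltnW jk).
have [Lg' wg'] := sobolev_wderiv sust jk.
have [dust dE] := diff_upto_lin 1 (-1) usj utj.
have E : (fun x => 1 * u s x + -1 * u t x) = (fun x => u s x - u t x).
  by apply/funext => y; rewrite mul1r mulN1r.
rewrite E in dust dE.
have -> : derive1n j (u s) x - derive1n j (u t) x = derive1n j (fun x => u s x - u t x) x.
  by rewrite dE mul1r mulN1r.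
apply: le_trans (hM _ _ _ _ dust Lg Lg' wg wg' x) _.
have b i : (i <= k)%N -> L2norm (wderiv i (fun x => u s x - u t x)) <= e / (M * 2).
  move=> ik; rewrite -lee_fin; apply: le_trans (wderiv_le_sobolev_norm sust ik) _.
  exact/ltW/hd.
have -> : e = M * (e / (M * 2) + e / (M * 2)) by field; rewrite gt_eqF.
by rewrite ler_pM2l//; apply: lerD; apply: b => //; exact: ltnW.
Qed.

(** A Cauchy condition rather than a limit: the time derivative [v] is in [H^k] but has no classical
    derivatives at hand. It cancels between two quotients, leaving a combination of [u s], [u s']
    and [u t], to which the embedding applies. *)
Lemma C1_sobolev_uniform (R : realType) (T : \bar R) k j (u : R -> R -> R) (t e : R) :
  C1_sobolev T k u -> (j < k)%N -> lifetime T t -> diff_upto j (u t) -> 0 < e ->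
  exists2 d, 0 < d & forall s s', lifetime T s -> lifetime T s' ->
    s != t -> s' != t -> `|s - t| < d -> `|s' - t| < d ->
    diff_upto j (u s) -> diff_upto j (u s') -> forall x,
    `|(derive1n j (u s) x - derive1n j (u t) x) / (s - t) -
      (derive1n j (u s') x - derive1n j (u t) x) / (s' - t)| <= e.
Proof.
move=> [cu [v cv uv]] jk tT utj e0; have [M M0 hM] := sobolev_embedding R.
(* Two quotients, each measured in two weak orders. *)
have eM0 : 0 < e / (M * 4) by rewrite divr_gt0// mulr_gt0.
have /within_dball[d d0 hd] := cvge0_near (uv _ tT) eM0.
have [sut _] := cu _ tT; have [svt _] := cv _ tT.
pose q s x := (u s x - u t x) / (s - t) - v t x.
pose w j s := wderiv j (q s).
have qE s : q s = (fun x =>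
    1 * ((s - t)^-1 * u s x + (- (s - t)^-1) * u t x) + (-1) * v t x).
  by apply/funext => x; rewrite /q; ring.
have sq s : lifetime T s -> sobolev k (q s).
  move=> sT; rewrite qE; apply: sobolev_lin => //.
  by apply: sobolev_lin => //; exact: (cu _ sT).1.
have b s i : lifetime T s -> s != t -> `|s - t| < d -> (i <= k)%N ->
    L2 (w i s) /\ L2norm (w i s) <= e / (M * 4).
  move=> sT st std ik; have sqs := sq _ sT.
  split; first exact: (sobolev_wderiv sqs ik).1.
  rewrite -lee_fin; apply: le_trans (wderiv_le_sobolev_norm sqs ik) _.
  exact/ltW/hd.
exists d => // s s' sT s'T st s't std s'td usj us'j x.
have Lwd i : (i <= k)%N -> L2 (fun x => w i s x - w i s' x) /\
    L2norm (fun x => w i s x - w i s' x) <= e / (M * 2).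
  move=> ik; have [L n] := b _ _ sT st std ik.
  have [L' n'] := b _ _ s'T s't s'td ik.
  split; first exact: L2B.
  apply: le_trans (L2norm_triangle L L') _.
  have -> : e / (M * 2) = e / (M * 4) + e / (M * 4) by field; rewrite gt_eqF.
  exact: lerD.
(* The same function as [q s - q s'], but free of [v t]: this form has classical derivatives, the
   other one has small weak derivatives. *)
pose h x := 1 * ((s - t)^-1 * u s x + (- (s - t)^-1) * u t x) +
  (-1) * ((s' - t)^-1 * u s' x + (- (s' - t)^-1) * u t x).
have hE : h = (fun x => 1 * q s x + (-1) * q s' x).
  by apply/funext => y; rewrite !qE /h; ring.
have wh i : (i <= k)%N -> weak_derivative i h (fun x => w i s x - w i s' x).
  move=> ik; rewrite hE.
  have -> : (fun x => w i s x - w i s' x) = (fun x => 1 * w i s x + (-1) * w i s' x).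
    by apply/funext => y; ring.
  have [Lw ww] := sobolev_wderiv (sq _ sT) ik.
  have [Lw' ww'] := sobolev_wderiv (sq _ s'T) ik.
  exact: (weak_derivative_lin 1 (-1) (sq _ sT).1 (sq _ s'T).1 Lw Lw' ww ww').
have [dh1 E1] := diff_upto_lin (s - t)^-1 (- (s - t)^-1) usj utj.
have [dh2 E2] := diff_upto_lin (s' - t)^-1 (- (s' - t)^-1) us'j utj.
have [dh E] := diff_upto_lin 1 (-1) dh1 dh2.
have [L0 n0] := Lwd _ (ltnW jk); have [L1 n1] := Lwd _ jk.
have := hM _ _ _ _ dh L0 L1 (wh _ (ltnW jk)) (wh _ jk) x.
rewrite E E1 E2 => hx.
have -> : (derive1n j (u s) x - derive1n j (u t) x) / (s - t) -
      (derive1n j (u s') x - derive1n j (u t) x) / (s' - t) =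
  1 * ((s - t)^-1 * derive1n j (u s) x + - (s - t)^-1 * derive1n j (u t) x) +
     -1 * ((s' - t)^-1 * derive1n j (u s') x + - (s' - t)^-1 * derive1n j (u t) x) by ring.
apply: le_trans hx _.
have -> : e = M * (e / (M * 2) + e / (M * 2)) by field; rewrite gt_eqF.
by rewrite ler_pM2l//; exact: lerD.
Qed.

(** * Vanishing at a fixed time *)

(** The mean value theorem replaces the integral of [f'], on which no continuity is assumed. *)
Lemma is_derive_ge_increment (R : realType) (f f' : R -> R) (a b c : R) : a <= b ->
  (forall x : R, is_derive x 1 f (f' x)) ->
  (forall x, a <= x <= b -> c <= f' x) -> c * (b - a) <= f b - f a.
Proof.
move=> ab fd f'c.
have cf : {within `[a, b], continuous f}.
  by apply: continuous_subspaceT => x; exact: is_derive1_continuous (fd x).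
have [x xab ->] := @MVT_segment R f f' a b ab (fun x _ => fd x) cf.
by rewrite ler_wpM2r ?subr_ge0// f'c// -in_itv.
Qed.

Definition bounded_fct (R : realType) (f : R -> R) : Prop :=
  exists K, forall x, `|f x| <= K.

Lemma bounded_fctD (R : realType) (f g : R -> R) :
  bounded_fct f -> bounded_fct g -> bounded_fct (fun x => f x + g x).
Proof.
move=> [K fK] [L gL]; exists (K + L) => x.
by apply: le_trans (ler_normD _ _) _; exact: lerD.
Qed.

Lemma bounded_fctN (R : realType) (f : R -> R) :
  bounded_fct f -> bounded_fct (fun x => - f x).
Proof. by move=> [K fK]; exists K => x; rewrite normrN. Qed.

Lemma bounded_fctM (R : realType) (f g : R -> R) :
  bounded_fct f -> bounded_fct g -> bounded_fct (fun x => f x * g x).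
Proof.
move=> [K fK] [L gL]; exists (K * L) => x.
by rewrite normrM ler_pM.
Qed.

Lemma bounded_fctC (R : realType) (c : R) : bounded_fct (fun=> c).
Proof. by exists `|c|. Qed.

Lemma is_derive_expRN (R : realType) (x : R) :
  is_derive x 1 (fun y => expR (- y)) (- expR (- x)).
Proof.
have := is_derive1_comp (is_derive_expR (- x)) (is_derive1N (is_derive_id x 1)).
by rewrite mulrN1.
Qed.

Lemma expRN_small (R : realType) (B c z0 : R) : 0 < c ->
  exists2 z, z0 <= z & B * expR (- z) < c.
Proof.
(* At this point [exp z >= 1 + z > |B| / c]. *)
move=> c0; exists (`|z0| + `|B| / c); first by rewrite ler_wpDr ?divr_ge0 ?ler_norm// ltW.
set z := _ + _; have z0' : 0 <= z by rewrite addr_ge0 ?divr_ge0// ltW.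
apply: le_lt_trans (_ : `|B| * expR (- z) < _).
  by rewrite ler_wpM2r ?expR_ge0// ler_norm.
rewrite expRN ltr_pdivrMr ?expR_gt0//.
apply: lt_le_trans (_ : c * (1 + z) <= _); last by rewrite ler_pM2l// expR_ge1Dx.
rewrite /z !mulrDr mulrCA divff ?gt_eqF// !mulr1.
by rewrite ltr_pwDl// lerDr mulr_ge0// ltW.
Qed.

(* With [sigma] below, [exp(-x)(k + k' - sigma - e)] has derivative
   [exp(-x)(U^2 + U'^2/2 + (e - (k - k'' + F')))], where
   [F = (U - gamma)(U - U'') + (U^2 - U'^2)/2]. *)
Lemma half_line_vanishing (R : realType) (gamma y : R) (U0 U1 U2 U3 : R -> R) :
  (forall x : R, is_derive x 1 U0 (U1 x)) ->
  (forall x : R, is_derive x 1 U1 (U2 x)) ->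
  (forall x : R, is_derive x 1 U2 (U3 x)) ->
  bounded_fct U0 -> bounded_fct U1 -> bounded_fct U2 ->
  U0 y = 0 -> U1 y = 0 -> U2 y = 0 ->
  (forall e : R, 0 < e -> exists k0 k1 k2 : R -> R,
    [/\ forall x : R, is_derive x 1 k0 (k1 x),
        forall x : R, is_derive x 1 k1 (k2 x),
        bounded_fct k0 /\ bounded_fct k1, k0 y = 0 /\ k1 y = 0 &
        forall x, `|k0 x - k2 x + ((U0 x - gamma) * (U1 x - U3 x) +
                                   2 * U1 x * (U0 x - U2 x))| <= e]) ->
  forall x, y <= x -> U0 x = 0.
Proof.
move=> d0 d1 d2 b0 b1 b2 y0 y1 y2 hk x1; rewrite le_eqVlt => /predU1P[<-//|yx1].
apply/eqP/negP => /negP Ux1.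
pose m := `|U0 x1| / 2; have m0 : 0 < m by rewrite divr_gt0 ?normr_gt0.
have [r /andP[r0 r1] Ur] : exists2 r : R, 0 < r <= 1 &
    forall z, x1 <= z <= x1 + r -> m <= `|U0 z|.
  have /cvgrPdist_lt/(_ _ m0) := is_derive1_continuous (d0 x1).
  move=> /nbhs_ballP[r /= r0 hr].
  exists (Num.min (r / 2) 1) => [|z /andP[xz zx]].
    by rewrite lt_min ltr01 divr_gt0//= ge_min lexx orbT.
  have /hr/= : ball x1 r z.
    rewrite /ball/= distrC ger0_norm ?subr_ge0//.
    rewrite ltrBlDl; apply: le_lt_trans zx _; rewrite ltrD2l gt_min.
    by rewrite ltr_pdivrMr// ltr_pMr// ltr1n.
  have := ler_normD (U0 z) (U0 x1 - U0 z); rewrite addrC subrK /m; lra.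
(* Lower bound of [exp(-x) U0^2] on [[x1, x1 + r]], since [r <= 1]. *)
pose kappa := expR (- (x1 + 1)) * m ^+ 2.
have kappa0 : 0 < kappa by rewrite mulr_gt0 ?expR_gt0// exprn_gt0.
(* [P] starts at [- e exp(-y)]; with this [e] the deficit is half of the gain [kappa * r]. The
   functions [k] are obtained only afterwards, so their bounds may depend on [e]. *)
pose e := kappa * r * expR y / 2.
have e0 : 0 < e by rewrite /e divr_gt0 ?ltr0n// (mulr_gt0 (mulr_gt0 kappa0 r0)) ?expR_gt0.
have [k0 [k1 [k2 [dk0 dk1 [bk0 bk1] [k0y k1y] ke]]]] := hk e e0.
(* With [f = U^2 + U'^2/2] and [F' = (1 - d_x^2)((U - gamma) U') + f'], the equation
   [(1 - d_x) sigma = f - F'] has the solution [sigma = f - (1 + d_x)((U - gamma) U')], expanded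
   here. No third derivative occurs in it, so it is bounded. *)
pose sigma x := (U0 x - gamma) * (U0 x - U2 x) + 2^-1 * (U0 x * U0 x - U1 x * U1 x)
  - U0 x * U1 x - 2^-1 * (U0 x * U0 x) + gamma * (U1 x + U0 x).
pose P x := expR (- x) * (k0 x + k1 x - sigma x - e).
pose P' x := expR (- x) * (U0 x ^+ 2 + U1 x ^+ 2 / 2 +
   (e - (k0 x - k2 x + ((U0 x - gamma) * (U1 x - U3 x) + 2 * U1 x * (U0 x - U2 x))))).
have dP (x : R) : is_derive x 1 P (P' x).
  have dg : is_derive x 1 (fun=> gamma) 0 by exact: is_derive_cst.
  have de : is_derive x 1 (fun=> e) 0 by exact: is_derive_cst.
  have ds := is_derive1D (is_derive1B (is_derive1B (is_derive1D
    (is_derive1M (is_derive1B (d0 x) dg) (is_derive1B (d0 x) (d2 x)))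
    (is_derive1Ml 2^-1 (is_derive1B (is_derive1M (d0 x) (d0 x)) (is_derive1M (d1 x) (d1 x)))))
    (is_derive1M (d0 x) (d1 x))) (is_derive1Ml 2^-1 (is_derive1M (d0 x) (d0 x))))
    (is_derive1Ml gamma (is_derive1D (d1 x) (d0 x))).
  have := is_derive1M (is_derive_expRN x)
    (is_derive1B (is_derive1B (is_derive1D (dk0 x) (dk1 x)) ds) de).
  move/is_derive1_eq; apply.
  by rewrite /P' /sigma; field.
have P'ge x : expR (- x) * U0 x ^+ 2 <= P' x.
  rewrite ler_pM2l ?expR_gt0//; have := ke x; have := sqr_ge0 (U1 x).
  by rewrite ler_norml => ? /andP[? ?]; lra.
have incr a b : a <= b -> P a <= P b.
  move=> ab; rewrite -subr_ge0 -(mul0r (b - a)).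
  apply: (is_derive_ge_increment ab dP) => x _.
  by apply: le_trans (P'ge x); rewrite mulr_ge0 ?expR_ge0// sqr_ge0.
have Py : P y = - (e * expR (- y)).
  by rewrite /P /sigma y0 y1 y2 k0y k1y; ring.
have incr1 : kappa * r <= P (x1 + r) - P x1.
  have h : x1 <= x1 + r by rewrite lerDl ltW.
  have := @is_derive_ge_increment _ _ _ _ _ kappa h dP; rewrite addrAC subrr add0r; apply.
  move=> x /andP[xl xr]; apply: le_trans (P'ge x).
  apply: ler_pM; rewrite ?expR_ge0 ?sqr_ge0//.
    by rewrite ler_expR; lra.
  by rewrite -[leRHS]real_normK ?num_real// ler_pXn2r ?nnegrE ?(ltW m0)// Ur ?xl.
have eE : e * expR (- y) = kappa * r / 2.
  by rewrite /e expRN; field; rewrite gt_eqF// expR_gt0.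
have Pbig : kappa * r / 2 <= P (x1 + r).
  have := incr _ _ (ltW yx1); rewrite Py eE; lra.
have [B hB] : bounded_fct (fun x => k0 x + k1 x - sigma x - e).
  by rewrite /sigma; do ?[exact: bounded_fctC | assumption | apply: bounded_fctM
    | apply: bounded_fctN | apply: bounded_fctD].
(* [P] is nondecreasing and at least [kappa * r / 2] from [x1 + r] on, yet it is a bounded function
   times exp(-x). *)
have [|z zx Bz] := @expRN_small _ B (kappa * r / 2) (x1 + r).
  by rewrite divr_gt0// mulr_gt0.
have := incr _ _ zx; apply/negP; rewrite -ltNge.
apply: lt_le_trans Pbig; apply: le_lt_trans Bz.
rewrite /P [leLHS]mulrC ler_wpM2r ?expR_ge0//.
exact: le_trans (ler_norm _) (hB z).
Qed.

Lemma is_derive1_reflect (R : realType) (f f' : R -> R) (x : R) :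
  (forall x : R, is_derive x 1 f (f' x)) ->
  is_derive x 1 (fun y => f (- y)) (- f' (- x)).
Proof.
move=> fd; have := is_derive1_comp (fd (- x)) (is_derive1N (is_derive_id x 1)).
by rewrite mulrN1.
Qed.

(* The equation is invariant under [u(x) -> - u(-x)], [gamma -> - gamma]. *)
Lemma line_vanishing (R : realType) (gamma y : R) (U0 U1 U2 U3 : R -> R) :
  (forall x : R, is_derive x 1 U0 (U1 x)) ->
  (forall x : R, is_derive x 1 U1 (U2 x)) ->
  (forall x : R, is_derive x 1 U2 (U3 x)) ->
  bounded_fct U0 -> bounded_fct U1 -> bounded_fct U2 ->
  U0 y = 0 -> U1 y = 0 -> U2 y = 0 ->
  (forall e : R, 0 < e -> exists k0 k1 k2 : R -> R,
    [/\ forall x : R, is_derive x 1 k0 (k1 x),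
        forall x : R, is_derive x 1 k1 (k2 x),
        bounded_fct k0 /\ bounded_fct k1, k0 y = 0 /\ k1 y = 0 &
        forall x, `|k0 x - k2 x + ((U0 x - gamma) * (U1 x - U3 x) +
                                   2 * U1 x * (U0 x - U2 x))| <= e]) ->
  forall x, U0 x = 0.
Proof.
move=> d0 d1 d2 b0 b1 b2 y0 y1 y2 hk x.
have [yx|xy] := leP y x; first exact: (half_line_vanishing d0 d1 d2 b0 b1 b2 y0 y1 y2 hk).
have bc (f : R -> R) : bounded_fct f -> bounded_fct (fun x => f (- x)).
  by move=> [K fK]; exists K => z.
have := @half_line_vanishing R (- gamma) (- y) (fun x => - U0 (- x))
  (fun x => U1 (- x)) (fun x => - U2 (- x)) (fun x => U3 (- x)).
move=> /(_ _ _ _ _ _ _ _ _ _ _ (- x)) h; apply/eqP; rewrite -oppr_eq0 -{1}(opprK x).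
apply/eqP; apply: h => //.
- move=> z; have := is_derive1N (is_derive1_reflect z d0); by rewrite opprK.
- move=> z; exact: is_derive1_reflect d1.
- move=> z; have := is_derive1N (is_derive1_reflect z d2); by rewrite opprK.
- exact/bounded_fctN/bc.
- exact: bc.
- exact/bounded_fctN/bc.
- by rewrite opprK y0 oppr0.
- by rewrite opprK y1.
- by rewrite opprK y2 oppr0.
- move=> e /hk[k0 [k1 [k2 [dk0 dk1 [bk0 bk1] [k0y k1y] ke]]]].
  exists (fun x => - k0 (- x)), (fun x => k1 (- x)), (fun x => - k2 (- x)); split.
  + move=> z; have := is_derive1N (is_derive1_reflect z dk0); by rewrite opprK.
  + move=> z; exact: is_derive1_reflect dk1.
  + by split; [exact/bounded_fctN/bc|exact: bc].
  + by rewrite opprK k0y k1y oppr0.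
  + move=> z; rewrite -normrN; apply: le_trans (ke (- z)).
    by rewrite le_eqVlt; apply/orP; left; apply/eqP; congr `|_|; ring.
- by rewrite lerN2 ltW.
Qed.

(** * Maximum principle for a linear transport equation *)

Lemma is_derive_left_max_ge0 (R : realType) (f : R -> R) (a t l : R) : a < t ->
  is_derive t 1 f l -> (forall s, a <= s <= t -> f s <= f t) -> 0 <= l.
Proof.
move=> at_ /is_derive1_caratheodory[g [fg cg gl]] ft.
rewrite leNgt; apply/negP => l0; rewrite -gl in l0.
have /nbhs_ballP[r /= r0 hr] : \forall s \near t, g s < 0 by exact: cvgr_lt cg _ l0.
pose s := Num.max a (t - r / 2).
have st : s < t by rewrite gt_max at_/= gtrBl divr_gt0.
have /hr/= gs : ball t r s.
  rewrite /ball/= gtr0_norm ?subr_gt0// ltrBlDr -ltrBlDl lt_max; apply/orP; right.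
  by rewrite ltrD2l ltrN2 ltr_pdivrMr// ltr_pMr// ltr1n.
have : f s <= f t by apply: ft; rewrite le_max lexx/= ltW.
by rewrite -subr_le0 fg; apply/negP; rewrite -ltNge nmulr_rgt0 ?subr_lt0.
Qed.

(** The weight makes [z = m^2 w] attain its maximum although space is unbounded. There [z_x = 0]
    reads [mx (1 + x^2) = x m], and [2 |x| <= 1 + x^2] bounds [2 a m mx] by [A m^2]. So
    [z_t <= (A + 2 B - l) m^2 w], which is negative for the chosen [l], while a maximum at a
    positive time forces [z_t >= 0]. *)
Lemma transport_uniqueness (R : realType) (m mx a b : R -> R -> R) (d A B K : R) :
  (forall t x e : R, 0 <= t <= d -> 0 < e -> exists2 r : R, 0 < r &
    forall s z : R, 0 <= s <= d -> `|s - t| < r -> `|z - x| < r ->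
      `|m s z - m t x| < e) ->
  (forall x, m 0 x = 0) ->
  (forall t x : R, 0 <= t <= d -> [/\ `|m t x| <= K, `|a t x| <= A & `|b t x| <= B]) ->
  (forall t x : R, 0 < t <= d -> is_derive x 1 (m t) (mx t x) /\
    is_derive t 1 (fun s => m s x) (a t x * mx t x + b t x * m t x)) ->
  forall t x : R, 0 <= t <= d -> m t x = 0.
Proof.
move=> mc m0 bd eqm t1 x1 t1d; apply/eqP/negP => /negP m1.
pose l := A + 2 * B + 1.
pose w (t x : R) := expR (- (l * t)) * (1 + x * x)^-1.
have den (x : R) : 0 < 1 + x * x by rewrite ltr_pwDl// -expr2 sqr_ge0.
have w0 (t x : R) : 0 < w t x by rewrite mulr_gt0 ?expR_gt0// invr_gt0.
pose z (t x : R) := (m t x * m t x) * w t x.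
have A0 : 0 <= A by have [_ + _] := bd t1 x1 t1d; apply: le_trans.
have B0 : 0 <= B by have [_ _] := bd t1 x1 t1d; apply: le_trans.
have K0 : 0 <= K by have [+ _ _] := bd t1 x1 t1d; apply: le_trans.
have l0 : 0 < l by rewrite /l; lra.
have z1 : 0 < z t1 x1 by rewrite mulr_gt0// -expr2 exprn_even_gt0.
(* For [|x| >= N >= 1] one has [x^2 >= N > K^2 / z t1 x1], so [z <= K^2 / (1 + x^2)] falls below its
   value at [(t1, x1)]. *)
pose N : R := `|x1| + K * K / z t1 x1 + 1.
have KN : 0 <= K * K / z t1 x1 by exact: divr_ge0 (mulr_ge0 K0 K0) (ltW z1).
have x1N : `|x1| <= N by rewrite /N; lra.
have zN (t x : R) : 0 <= t <= d -> N <= `|x| -> z t x < z t1 x1.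
  move=> td Nx; have [mK _ _] := bd t x td.
  have mm : m t x * m t x <= K * K.
    by rewrite -[leLHS]ger0_norm -?expr2 ?sqr_ge0// normrX ler_pXn2r ?nnegrE.
  have e1 : expR (- (l * t)) <= 1.
    have /andP[t0 _] := td.
    by rewrite expR_le1 oppr_le0; exact: mulr_ge0 (ltW l0) t0.
  have xx : N <= x * x.
    have N1 : 1 <= N by have := normr_ge0 x1; rewrite /N; lra.
    rewrite -[leRHS]ger0_norm -?expr2 ?sqr_ge0// normrX expr2.
    by apply: le_trans (_ : N * 1 <= _); [rewrite mulr1|apply: ler_pM => //; lra].
  have h : z t x <= K * K * (1 + x * x)^-1.
    rewrite /z /w; apply: ler_pM => //.
    - by rewrite -expr2 sqr_ge0.
    - exact: ltW (w0 _ _).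
    - by rewrite ler_piMl// invr_ge0 ltW.
  apply: le_lt_trans h _; rewrite ltr_pdivrMr// [ltRHS]mulrC -ltr_pdivrMr//.
  by have := normr_ge0 x1; rewrite /N in xx *; lra.
pose E : set (R * R) := `[0, d] `*` `[- N, N].
have cE : compact E by apply: compact_setX; exact: segment_compact.
have [||[ts xs] /= tsE zmax] := @compact_EVT_max _ R (fun p : R * R => z p.1 p.2) E _ cE.
- exists (t1, x1); split => /=; rewrite in_itv/=//.
  by rewrite -ler_norml.
- apply/subspace_continuousP => -[t x] [/= td xN].
  rewrite in_itv/= in td.
  have cm : m p.1 p.2 @[p --> within E (nbhs (t, x))] --> m t x.
    apply/cvgrPdist_lt => e e0; have [r r0 hr] := mc t x e td e0.
    rewrite near_withinE; near=> p => -[/=]; rewrite in_itv/= => pd _.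
    rewrite distrC; apply: hr => //; rewrite distrC.
      by near: p; apply: (@cvgr_dist_lt _ _ _ _ _ fst t) => //; exact: cvg_fst.
    by near: p; apply: (@cvgr_dist_lt _ _ _ _ _ snd x) => //; exact: cvg_snd.
  apply: cvgM; first exact: cvgM.
  apply: cvg_within_filter; apply: cvgM.
    apply: continuous_cvg; first exact: continuous_expR.
    apply: cvgN; apply: cvgM; [exact: cvg_cst|exact: cvg_fst].
  apply: cvgV; first by rewrite gt_eqF.
  apply: cvgD; first exact: cvg_cst.
  by apply: cvgM; exact: cvg_snd.
move: tsE; rewrite inE => -[/=]; rewrite !in_itv/= => tsd xsN.
have zm (t x : R) : 0 <= t <= d -> - N <= x <= N -> z t x <= z ts xs.
  by move=> td xN; apply: (zmax (t, x)); rewrite inE; split; rewrite /= in_itv.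
have zs : z t1 x1 <= z ts xs by apply: zm => //; rewrite -ler_norml.
have ts0 : 0 < ts.
  rewrite lt_neqAle eq_sym; case/andP: (tsd) => -> _; rewrite andbT.
  apply/eqP => ts0; have := lt_le_trans z1 zs.
  by rewrite /z ts0 m0 !mul0r ltxx.
have xsi : - N < xs < N.
  rewrite -ltr_norml ltNge; apply/negP => Nx.
  by have := zN _ _ tsd Nx; rewrite ltNge zs.
have tsd' : 0 < ts <= d by rewrite ts0; case/andP: tsd.
have [dx dt] := eqm ts xs tsd'.
have M2 : 0 < m ts xs * m ts xs.
  have : 0 < z ts xs by exact: lt_le_trans zs.
  by rewrite /z pmulr_lgt0.
have dE (t : R) : is_derive t 1 (fun t => expR (- (l * t))) (- l * expR (- (l * t))).
  have := is_derive1_comp (is_derive_expR _) (is_derive1N (is_derive1Ml l (is_derive_id t 1))).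
  by rewrite mulr1 [_ * - l]mulrC.
have dD (x : R) : is_derive x 1 (fun x => (1 + x * x)^-1) (- ((2 * x) / (1 + x * x) ^+ 2)).
  have d1 : is_derive x 1 (fun=> 1 : R) 0 by exact: is_derive_cst.
  have := @is_derive1V R (fun y => 1 + y * y) x _ (lt0r_neq0 (den x))
    (is_derive1D d1 (is_derive1M (is_derive_id x 1) (is_derive_id x 1))).
  by move/is_derive1_eq; apply; congr (- (_ / _)); ring.
have dzx (x : R) : is_derive x 1 (z ts)
    ((mx ts x * m ts x + m ts x * mx ts x) * w ts x + (m ts x * m ts x) *
     (expR (- (l * ts)) * - ((2 * x) / (1 + x * x) ^+ 2))).
  have [dx' _] := eqm ts x tsd'.
  exact: is_derive1M (is_derive1M dx' dx') (is_derive1Ml _ (dD x)).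
have dzt := is_derive1M (is_derive1M dt dt)
  (is_derive1M (dE ts) (is_derive_cst (1 + xs * xs)^-1 ts 1)).
have zx0 : is_derive xs 1 (z ts) 0.
  apply: (@derive1_at_max _ _ (- N) N).
  - by have /andP[h1 h2] := xsN; exact: le_trans h1 h2.
  - by move=> x _; case: (dzx x).
  - by rewrite in_itv.
  - by move=> x; rewrite in_itv/= => /andP[h1 h2]; apply: zm => //; rewrite !ltW.
have dzt' : is_derive ts 1 (z^~ xs) ((2 * m ts xs *
    (a ts xs * mx ts xs + b ts xs * m ts xs) - l * (m ts xs * m ts xs)) * w ts xs).
  by apply: (is_derive1_eq dzt); rewrite /w /=; ring.
(* The maximum may sit at the final time [d], so only earlier times are compared. *)
have zt0 : 0 <= (2 * m ts xs * (a ts xs * mx ts xs + b ts xs * m ts xs) -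
    l * (m ts xs * m ts xs)) * w ts xs.
  apply: (is_derive_left_max_ge0 ts0 dzt') => s /andP[s0 sts]; apply: zm => //.
  by rewrite s0; case/andP: tsd => _; exact: le_trans.
rewrite pmulr_lge0// subr_ge0 in zt0.
have [_ e1] := dzx xs; have [_ e2] := zx0; rewrite e2 {e2 zx0 dzt dzt' dzx dE dx dt} in e1.
(* The condition [z_x = 0], divided by [m] and by the positive weight. *)
have {}e1 : mx ts xs * (1 + xs * xs) = xs * m ts xs.
  have M0 : m ts xs != 0 by apply: contraTneq M2 => ->; rewrite mul0r ltxx.
  apply: (mulfI M0); apply/eqP; rewrite -subr_eq0; apply/eqP.
  have e0 : 2 * expR (- (l * ts)) / (1 + xs * xs) ^+ 2 != 0.
    by rewrite !mulf_neq0// ?gt_eqF ?invr_gt0 ?exprn_gt0 ?expR_gt0// ltr0n.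
  apply: (mulfI e0); rewrite mulr0 [RHS]e1 /w.
  by field; rewrite gt_eqF.
have [_ aA bB] := bd ts xs tsd.
have {}zt0 : l * (1 + xs * xs) <= 2 * (a ts xs * xs) + 2 * b ts xs * (1 + xs * xs).
  rewrite -(ler_pM2l M2).
  have -> : m ts xs * m ts xs * (2 * (a ts xs * xs) + 2 * b ts xs * (1 + xs * xs)) =
    (2 * m ts xs * (a ts xs * mx ts xs + b ts xs * m ts xs)) * (1 + xs * xs).
    transitivity (2 * m ts xs * a ts xs * (mx ts xs * (1 + xs * xs)) +
                  2 * b ts xs * (1 + xs * xs) * (m ts xs * m ts xs)).
      by rewrite e1; ring.
    by ring.
  by rewrite mulrA ler_pM2r// mulrC.
have ax : 2 * (a ts xs * xs) <= A * (1 + xs * xs).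
  apply: le_trans (ler_norm _) _; rewrite !normrM ger0_norm// mulrCA.
  apply: ler_pM => //.
  have -> : xs * xs = `|xs| * `|xs| by rewrite -normrM ger0_norm// -expr2 sqr_ge0.
  by rewrite -subr_ge0 (_ : _ - _ = (`|xs| - 1) ^+ 2) ?sqr_ge0//; ring.
have bx : 2 * b ts xs * (1 + xs * xs) <= 2 * B * (1 + xs * xs).
  by rewrite ler_pM2r// ler_pM2l//; exact: le_trans (ler_norm _) bB.
have : l * (1 + xs * xs) <= A * (1 + xs * xs) + 2 * B * (1 + xs * xs).
  by apply: le_trans zt0 _; exact: lerD.
by rewrite -mulrDl ler_pM2r// /l; apply/negP; rewrite -ltNge; lra.
Unshelve. all: by end_near. Qed.

(** * The DGH equation *)

Lemma derive1n_locally_zero (R : realType) i (f : R -> R) (a b : R) :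
  (forall x, a < x < b -> f x = 0) ->
  forall x, a < x < b -> derive1n i f x = 0.
Proof.
move=> f0; elim: i => [//|i IH] x xab; rewrite derive1nS derive1E.
have h : \forall y \near x, 0 = derive1n i f y.
  case/andP: xab => ax xb; near=> y; apply/esym/IH.
  by apply/andP; split; near: y; [exact: lt_nbhsr|exact: lt_nbhsl].
by have [_] := @near_eq_is_derive R R R (fun=> 0) _ x 1 0 h (is_derive_cst _ _ _).
Unshelve. all: by end_near. Qed.

(** [exp(-x)(f + f')] is constant and tends to 0 at plus infinity, so [f' = - f]; then [exp(x) f] is
    constant and tends to 0 at minus infinity. *)
Lemma bounded_eq_derive2_zero (R : realType) (f0 f1 : R -> R) :
  (forall x : R, is_derive x 1 f0 (f1 x)) ->
  (forall x : R, is_derive x 1 f1 (f0 x)) ->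
  bounded_fct f0 -> bounded_fct f1 -> forall x, f0 x = 0.
Proof.
move=> d0 d1 b0 b1 x.
have [K hK] := bounded_fctD b0 b1; have [L hL] := b0.
have sum0 y : f0 y + f1 y = 0.
  pose q y := expR (- y) * (f0 y + f1 y).
  have dq (z : R) : is_derive z 1 q 0.
    have := is_derive1M (is_derive_expRN z) (is_derive1D (d0 z) (d1 z)).
    by move/is_derive1_eq; apply; ring.
  have q0 : q y = 0.
    apply/eqP; rewrite -normr_le0; apply/ler_addgt0Pr => e e0; rewrite add0r.
    have [z _ Kz] := @expRN_small R K e 0 e0.
    rewrite (is_derive_0_is_cst y z dq) /q normrM ger0_norm ?expR_ge0//.
    apply: le_trans (ltW Kz); rewrite mulrC ler_wpM2r ?expR_ge0//.
  by move/eqP: q0; rewrite mulf_eq0 gt_eqF ?expR_gt0// => /eqP.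
pose p y := expR y * f0 y.
have dp (z : R) : is_derive z 1 p 0.
  have := is_derive1M (is_derive_expR z) (d0 z); move/is_derive1_eq; apply.
  by rewrite -mulrDr sum0 mulr0.
have p0 : p x = 0.
  apply/eqP; rewrite -normr_le0; apply/ler_addgt0Pr => e e0; rewrite add0r.
  have [z _ Kz] := @expRN_small R L e 0 e0.
  rewrite (is_derive_0_is_cst x (- z) dp) /p normrM ger0_norm ?expR_ge0//.
  by apply: le_trans (ltW Kz); rewrite mulrC ler_wpM2r ?expR_ge0//.
by move/eqP: p0; rewrite mulf_eq0 gt_eqF ?expR_gt0// => /eqP.
Qed.

Lemma difference_quotientB (R : realType) (a b c d h q : R) : h != 0 ->
  (a - b) - (c - d) = q * h -> q = (a - c) / h - (b - d) / h.
Proof. by move=> h0 E; apply: (mulIf h0); rewrite -E; field. Qed.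

Lemma quotient_error (R : realType) (a0 b0 a2 b2 q q' w e : R) :
  `|a0 - b0| <= e / 4 -> `|a2 - b2| <= e / 4 -> `|q - q'| < e / 2 ->
  q' = b0 - b2 -> q = - w -> `|a0 - a2 + w| <= e.
Proof.
move=> h0 h2 hq qb qw; rewrite qb in hq.
have -> : a0 - a2 + w = (a0 - b0) - (a2 - b2) - (q - (b0 - b2)) by rewrite qw; ring.
apply: le_trans (ler_normB _ _) _.
by have := ler_normB (a0 - b0) (a2 - b2); lra.
Qed.

Lemma difference_error (R : realType) (a0 b0 a2 b2 q e : R) :
  `|a0 - b0| <= e / 4 -> `|a2 - b2| <= e / 4 -> `|q - (b0 - b2)| < e / 4 ->
  0 < e -> `|(a0 - a2) - q| < e.
Proof.
move=> h0 h2 hq e0.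
have -> : (a0 - a2) - q = (a0 - b0) - (a2 - b2) - (q - (b0 - b2)) by ring.
apply: le_lt_trans (ler_normB _ _) _.
by have := ler_normB (a0 - b0) (a2 - b2); lra.
Qed.

Lemma flux_split (R : realType) (sg v a b c : R) :
  - (v * a + 2 * b * c) * sg = - sg * v * a + - sg * (2 * b) * c.
Proof. by ring. Qed.

Section dgh.
Variables (R : realType) (omega gamma : R) (u0 : R -> R) (T : \bar R).
Variable u : R -> R -> R.
Implicit Types (s t x y z e d : R) (i : nat).
Hypothesis sol : dgh_solution omega gamma u0 T u.

Local Notation D i t := (derive1n i (u t)).
Local Notation m := (momentum u).
Local Notation inner t := (0 < t /\ (t%:E < T)%E).

Lemma inner_lifetime t : inner t -> lifetime T t.
Proof. by move=> [t0 tT]; split=> //; exact: ltW. Qed.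

Lemma sol_is_derive t i x : inner t -> (i < 3)%N -> is_derive x 1 (D i t) (D i.+1 t x).
Proof.
case: sol => _ _ _ _ h [t0 tT] i3; have [dj _ _] := h t x t0 tT.
by rewrite derive1nS; apply: derivable1_is_derive; exact: dj.
Qed.

(** Orders stop at 2: [D 3 t] is given only as the derivative of [D 2 t], without continuity. *)
Lemma sol_diff_upto t i : inner t -> (i < 3)%N -> diff_upto i (u t).
Proof.
move=> it i3; split=> [l x li|x].
  by case: (sol_is_derive x it (ltn_trans li i3)).
exact: is_derive1_continuous (sol_is_derive x it i3).
Qed.

(** The equation is imposed for positive times only, so at time 0 just the continuity of the profile
    is at hand. *)
Lemma sol_diff_upto0 t : lifetime T t -> diff_upto 0 (u t).
Proof. by move=> tT; split=> //; case: sol => _ _ c _ _; exact: c. Qed.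

Lemma sol_sobolev t : lifetime T t -> sobolev 4 (u t).
Proof. by move=> tT; case: sol => _ [c _] _ _ _; case: (c t tT). Qed.

Lemma sol_bounded t i : inner t -> (i < 3)%N -> bounded_fct (D i t).
Proof.
move=> it i3.
apply: (sobolev_bounded (sol_sobolev (inner_lifetime it)) _ (sol_diff_upto it i3)).
exact: leqW.
Qed.

Lemma sol_uniform t i e : inner t -> (i < 3)%N -> 0 < e ->
  exists2 d, 0 < d & forall s, inner s -> `|s - t| < d ->
    forall x, `|D i s x - D i t x| <= e.
Proof.
move=> it i3 e0; case: sol => _ [c _] _ _ _.
have [d d0 hd] := C0_sobolev_uniform c (leqW i3) (inner_lifetime it) (sol_diff_upto it i3) e0.
exists d => // s si st x; apply: hd => //; first exact: inner_lifetime.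
exact: sol_diff_upto.
Qed.

Lemma sol_uniform0 t e : lifetime T t -> 0 < e ->
  exists2 d, 0 < d & forall s, lifetime T s -> `|s - t| < d ->
    forall x, `|u s x - u t x| <= e.
Proof.
move=> tT e0; case: sol => _ [c _] _ _ _.
have [d d0 hd] := C0_sobolev_uniform c (isT : 0 < 4)%N tT (sol_diff_upto0 tT) e0.
exists d => // s sT st x; apply: hd => //; exact: sol_diff_upto0.
Qed.

Lemma sol_quotient t i e : inner t -> (i < 3)%N -> 0 < e ->
  exists2 d, 0 < d & forall s s', inner s -> inner s' -> s != t -> s' != t ->
    `|s - t| < d -> `|s' - t| < d -> forall x,
    `|(D i s x - D i t x) / (s - t) - (D i s' x - D i t x) / (s' - t)| <= e.
Proof.
move=> it i3 e0; case: sol => _ [_ c] _ _ _.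
have [d d0 hd] := C1_sobolev_uniform c i3 (inner_lifetime it) (sol_diff_upto it i3) e0.
exists d => // s s' si s'i st s't sd s'd x.
by apply: hd => //; (try exact: inner_lifetime); exact: sol_diff_upto.
Qed.

Lemma inner_ball t : inner t -> exists2 d, 0 < d & forall s, `|s - t| <= d -> inner s.
Proof.
move=> [t0 tT].
have [d1 d10 hd1] : exists2 d : R, 0 < d & ((t + d)%:E < T)%E.
  case: T tT => [r| |//].
    rewrite lte_fin => tr; exists ((r - t) / 2).
      by rewrite divr_gt0 ?subr_gt0.
    by rewrite lte_fin; lra.
  by exists 1 => //; rewrite ltry.
exists (Num.min d1 (t / 2)) => [|s]; first by rewrite lt_min d10 divr_gt0.
rewrite le_min => /andP[sd1 st2]; split.
  by move: st2; rewrite ler_norml => /andP[]; lra.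
apply: le_lt_trans hd1; rewrite lee_fin.
by move: sd1; rewrite ler_norml => /andP[]; lra.
Qed.

(** * The equation when [omega + gamma / 2 = 0] *)

Hypothesis c0 : omega + gamma / 2 = 0.

Definition flux_derivative t x := (u t x - gamma) * (D 1 t x - D 3 t x) +
  2 * D 1 t x * (u t x - D 2 t x).

Lemma momentum_is_derivex t x : inner t -> is_derive x 1 (m t) (D 1 t x - D 3 t x).
Proof.
move=> it; apply: is_derive1B; first exact: (sol_is_derive x it (isT : 0 < 3)%N).
exact: (sol_is_derive x it (isT : 2 < 3)%N).
Qed.

(** Here [2 omega u_x + gamma u_xxx = - gamma m_x], so the linear terms only shift the transport
    velocity from [u] to [u - gamma]. *)
Lemma momentum_is_derivet t x : inner t ->
  is_derive t 1 (fun s => m s x) (- flux_derivative t x).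
Proof.
move=> it; case: sol => _ _ _ _ h; have [t0 tT] := it.
have [_ dm eqn] := h t x t0 tT.
have := derivable1_is_derive dm; move/is_derive1_eq; apply.
have mx : derive1 (m t) x = D 1 t x - D 3 t x.
  by rewrite derive1E; case: (momentum_is_derivex x it).
have om : omega = - (gamma / 2) by apply/eqP; rewrite -addr_eq0 c0.
have aux (A B C M G U : R) : A + 2 * omega * B + U * C + 2 * B * M = - gamma * G ->
    C = B - G -> A = - ((U - gamma) * (B - G) + 2 * B * M).
  move=> E CE; rewrite CE in E.
  have -> : A = (A + 2 * omega * B + U * (B - G) + 2 * B * M) -
      (2 * omega * B + U * (B - G) + 2 * B * M) by ring.
  by rewrite E om; field.
exact: aux eqn mx.
Qed.

(** The role of [u_t] is played by the difference quotient [k] between [t] and one nearby time [s];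
    it vanishes with its derivatives at [y] because both profiles vanish around [y]. *)
Lemma vanishing_at t d a b : inner t -> 0 < d -> a < b ->
  (forall s x, `|s - t| < d -> a < x < b -> u s x = 0) -> forall x, u t x = 0.
Proof.
move=> it d0 ab ud.
pose y := (a + b) / 2; have yab : a < y < b by apply/andP; split; rewrite /y; lra.
have z s i : `|s - t| < d -> D i s y = 0.
  by move=> st; apply: (@derive1n_locally_zero R i (u s) a b) => // x; exact: ud.
have tt : `|t - t| < d by rewrite subrr normr0.
apply: (@line_vanishing R gamma y (u t) (D 1 t) (D 2 t) (D 3 t)).
- by move=> x; exact: (sol_is_derive x it (isT : 0 < 3)%N).
- by move=> x; exact: (sol_is_derive x it (isT : 1 < 3)%N).
- by move=> x; exact: (sol_is_derive x it (isT : 2 < 3)%N).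
- exact: (sol_bounded it (isT : 0 < 3)%N).
- exact: (sol_bounded it (isT : 1 < 3)%N).
- exact: (sol_bounded it (isT : 2 < 3)%N).
- exact: (z _ 0%N).
- exact: z.
- exact: z.
(* The budget: [e / 4] for each of the orders 0 and 2, and [e / 2] for the pointwise time derivative
   of [m]. *)
move=> e e0; have e4 : 0 < e / 4 by rewrite divr_gt0.
have [r0 r00 hr0] := sol_quotient it (isT : 0 < 3)%N e4.
have [r2 r20 hr2] := sol_quotient it (isT : 2 < 3)%N e4.
have [ri ri0 hri] := inner_ball it.
pose r := Num.min (Num.min r0 r2) (Num.min ri d).
have rpos : 0 < r by rewrite !lt_min r00 r20 ri0.
pose s := t + r / 2.
have st : s != t by rewrite /s -subr_eq0 addrAC subrr add0r gt_eqF// divr_gt0.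
have sr : `|s - t| < r.
  by rewrite /s addrAC subrr add0r gtr0_norm ?divr_gt0//; lra.
have rr v : `|v - t| < r -> [/\ `|v - t| < r0, `|v - t| < r2, inner v & `|v - t| < d].
  by rewrite !lt_min => /andP[/andP[? ?] /andP[/ltW/hri ? ?]].
have [sr0 sr2 si sd] := rr s sr.
pose k i x := (D i s x - D i t x) / (s - t).
have dk i (x : R) : (i < 3)%N -> is_derive x 1 (k i) (k i.+1 x).
  by move=> i3; apply: is_derive1Mr; apply: is_derive1B; exact: sol_is_derive.
have bk i : (i < 3)%N -> bounded_fct (k i).
  move=> i3; apply: bounded_fctM; last exact: bounded_fctC.
  by apply: bounded_fctD; [|apply: bounded_fctN]; exact: sol_bounded.
have ky i : k i y = 0 by rewrite /k !z// subrr mul0r.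
exists (k 0%N), (k 1%N), (k 2%N); split.
- by move=> x; exact: dk.
- by move=> x; exact: dk.
- by split; exact: bk.
- by split; exact: ky.
move=> x; have /is_derive1_caratheodory[g [fg cg gl]] := momentum_is_derivet x it.
have e2 : 0 < e / 2 by rewrite divr_gt0.
have /cvgrPdist_lt/(_ _ e2)/nbhs_ballP[r' /= r'0 hr'] := cg.
(* [s'] may depend on [x], since the differentiability of [m] in time is only pointwise; [s] may
   not, and the Cauchy estimates [hr0] and [hr2], uniform in [x], link the two. *)
pose s' := t + Num.min r r' / 2.
have rr'0 : 0 < Num.min r r' by rewrite lt_min rpos.
have s't : s' != t by rewrite /s' -subr_eq0 addrAC subrr add0r gt_eqF// divr_gt0.
have s'r : `|s' - t| < Num.min r r'.
  by rewrite /s' addrAC subrr add0r gtr0_norm ?divr_gt0//; lra.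
have [s'r1 s'r'] : `|s' - t| < r /\ `|s' - t| < r' by move: s'r; rewrite lt_min => /andP[].
have [s'r0 s'r2 s'i _] := rr s' s'r1.
have gs' : `|g t - g s'| < e / 2 by apply: hr'; rewrite /ball/= distrC.
have h0 := hr0 s s' si s'i st s't sr0 s'r0 x.
have h2 := hr2 s s' si s'i st s't sr2 s'r2 x.
have s't0 : s' - t != 0 by rewrite subr_eq0.
have gE := @difference_quotientB R (D 0 s' x) (D 2 s' x) (D 0 t x) (D 2 t x)
  (s' - t) (g s') s't0 (fg s').
exact: quotient_error h0 h2 gs' gE gl.
Qed.

(** Continuity in time uniform in space, together with continuity in space at the single time [t],
    gives joint continuity. *)
Lemma momentum_continuous t x e : inner t -> 0 < e -> exists2 r, 0 < r &
  forall s z, inner s -> `|s - t| < r -> `|z - x| < r -> `|m s z - m t x| < e.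
Proof.
move=> it e0; have e4 : 0 < e / 4 by rewrite divr_gt0.
have [r0 r00 hr0] := sol_uniform it (isT : 0 < 3)%N e4.
have [r2 r20 hr2] := sol_uniform it (isT : 2 < 3)%N e4.
have := is_derive1_continuous (momentum_is_derivex x it).
move=> /cvgrPdist_lt/(_ _ e4)/nbhs_ballP[r1 /= r10 hr1].
exists (Num.min r1 (Num.min r0 r2)) => [|s z si]; first by rewrite !lt_min r10 r00.
rewrite !lt_min => /and3P[_ sr0 sr2] /andP[zr1 _].
have h1 : `|m t x - m t z| < e / 4 by apply: hr1; rewrite /ball/= distrC.
have h0 := hr0 s si sr0 z; have h2 := hr2 s si sr2 z.
exact: difference_error h0 h2 h1 e0.
Qed.

(** The sign [sg] covers both directions of time: [s -> m (t + sg * s)] again solves a linear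
    transport equation starting from 0. *)
Lemma zero_propagates_dir t (sg : R) : sg = 1 \/ sg = -1 ->
  inner t -> (forall x, u t x = 0) ->
  exists2 d, 0 < d & forall s x, 0 <= s <= d -> u (t + sg * s) x = 0.
Proof.
move=> sgE it ut0.
have sg1 : `|sg| = 1 by case: sgE => ->; rewrite ?normrN normr1.
have Dt i x : D i t x = 0.
  by apply: (@derive1n_locally_zero _ _ _ (x - 1) (x + 1)) => //; apply/andP; split; lra.
have bnd i : (i < 3)%N -> exists2 d, 0 < d &
    forall s, inner s -> `|s - t| < d -> forall x, `|D i s x| <= 1.
  move=> i3; have [d d0 hd] := sol_uniform it i3 ltr01; exists d => // s si st x.
  by have := hd s si st x; rewrite Dt subr0.
have [r0 r00 hr0] := bnd 0%N isT; have [r1 r10 hr1] := bnd 1%N isT.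
have [r2 r20 hr2] := bnd 2%N isT; have [ri ri0 hri] := inner_ball it.
pose d := Num.min (Num.min r0 r1) (Num.min ri r2) / 2.
have d0 : 0 < d by rewrite divr_gt0// !lt_min r00 r10 ri0.
have sd s : 0 <= s <= d -> [/\ inner (t + sg * s), `|t + sg * s - t| < r0,
    `|t + sg * s - t| < r1 & `|t + sg * s - t| < r2].
  move=> /andP[s0 sd]; have : `|t + sg * s - t| < Num.min (Num.min r0 r1) (Num.min ri r2).
    by rewrite addrAC subrr add0r normrM sg1 mul1r ger0_norm//; rewrite /d in d0 sd; lra.
  by rewrite !lt_min => /andP[/andP[? ?] /andP[/ltW/hri ? ?]].
exists d => // s x hs; have [si sr0 sr1 sr2] := sd s hs.
have m0 z : m (t + sg * s) z = 0.
  (* [u], [u_x] and [u_xx] vanish at [t], so they stay below 1 nearby: hence [1 + |gamma|] for the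
     velocity, 2 for the factor [2 u_x], and 2 for [m] itself. *)
  apply: (@transport_uniqueness R (fun s => m (t + sg * s))
    (fun s x => D 1 (t + sg * s) x - D 3 (t + sg * s) x)
    (fun s x => - sg * (u (t + sg * s) x - gamma))
    (fun s x => - sg * (2 * D 1 (t + sg * s) x)) d (1 + `|gamma|) 2 2) => //.
  - move=> v w e vd e0; have [vi _ _ _] := sd v vd.
    have [r rpos hr] := momentum_continuous w vi e0.
    exists r => // v' w' v'd vv' ww'; apply: hr => //; first by have [] := sd _ v'd.
    have -> : t + sg * v' - (t + sg * v) = sg * (v' - v) by ring.
    by rewrite normrM sg1 mul1r.
  - by move=> w; rewrite mulr0 addr0 /momentum ut0 Dt subr0.
  - move=> v w vd; have [vi vr0 vr1 vr2] := sd v vd.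
    have h0 := hr0 _ vi vr0 w; have h1 := hr1 _ vi vr1 w; have h2 := hr2 _ vi vr2 w.
    split.
    + by apply: le_trans (ler_normB _ _) _; rewrite /= in h0; lra.
    + rewrite normrM normrN sg1 mul1r; apply: le_trans (ler_normB _ _) _.
      by rewrite lerD2r.
    + by rewrite !normrM normrN sg1 mul1r ger0_norm//; lra.
  - move=> v w /andP[v0 vd].
    have [vi _ _ _] := sd v (introT andP (conj (ltW v0) vd)).
    split; first exact: momentum_is_derivex.
    have dl : is_derive v 1 (fun v : R => t + sg * v) sg.
      have := is_derive1D (is_derive_cst t v 1) (is_derive1Ml sg (is_derive_id v 1)).
      by rewrite mulr1 add0r.
    apply: is_derive1_eq (@is_derive1_comp R (fun s => m s w) (fun v => t + sg * v) v _ _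
      (momentum_is_derivet w vi) dl) _.
    exact: flux_split.
(* Zero momentum says [u_xx = u], and [u] is bounded together with [u_x]. *)
have E : D 2 (t + sg * s) = u (t + sg * s).
  by apply/funext => z; have := m0 z; rewrite /momentum => /eqP; rewrite subr_eq0 => /eqP.
apply: (@bounded_eq_derive2_zero R (u (t + sg * s)) (D 1 (t + sg * s))).
- by move=> z; exact: (sol_is_derive z si (isT : 0 < 3)%N).
- by move=> z; rewrite -{2}E; exact: (sol_is_derive z si (isT : 1 < 3)%N).
- exact: (sol_bounded si (isT : 0 < 3)%N).
- exact: (sol_bounded si (isT : 1 < 3)%N).
Qed.

Lemma zero_propagates_locally t : inner t -> (forall x, u t x = 0) ->
  exists2 d, 0 < d & forall s, `|s - t| < d -> inner s /\ forall x, u s x = 0.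
Proof.
move=> it ut0.
have [d1 d10 h1] := zero_propagates_dir (or_introl erefl) it ut0.
have [d2 d20 h2] := zero_propagates_dir (or_intror erefl) it ut0.
have [ri ri0 hri] := inner_ball it.
exists (Num.min ri (Num.min d1 d2)) => [|s]; first by rewrite !lt_min ri0 d10.
rewrite !lt_min => /and3P[sri sd1 sd2]; split; first exact/hri/ltW.
move=> x; have [ts|st] := leP t s.
  have -> : s = t + 1 * (s - t) by ring.
  by apply: h1; rewrite subr_ge0 ts -(ger0_norm (_ : 0 <= s - t)) ?subr_ge0// ltW.
have -> : s = t + -1 * (t - s) by ring.
apply: h2; rewrite subr_ge0 (ltW st) -(ger0_norm (_ : 0 <= t - s)).
  by rewrite distrC ltW.
by rewrite subr_ge0 ltW.
Qed.

Lemma zero_everywhere t0 : inner t0 -> (forall x, u t0 x = 0) ->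
  forall t x, lifetime T t -> u t x = 0.
Proof.
move=> it0 ut0.
pose A := [set t | inner t]; pose B := [set t | inner t /\ forall x, u t x = 0].
have cA : connected A.
  apply/connected_intervalP => s t [s0 sT] [t1 tT] z /andP[sz zt].
  split; first exact: lt_le_trans sz.
  by apply: le_lt_trans tT; rewrite lee_fin.
have oB : open B.
  rewrite openE => t [it ut]; have [d d0 hd] := zero_propagates_locally it ut.
  by apply/nbhs_ballP; exists d => // s; rewrite /ball/= distrC; exact: hd.
have BA : B = A.
  apply: cA; first by exists t0.
    by exists B => //; apply/seteqP; split=> [t [it ut]|t [_]].
  (* [B] is closed in [A] by the continuity of [u] in time, uniform in space. *)
  exists (closure B); first exact: closed_closure.
  apply/seteqP; split=> [t Bt|t [it Bt]]; first by split; [case: Bt|exact: subset_closure].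
  split=> // x; apply/eqP; rewrite -normr_le0; apply/ler_addgt0Pr => e e0; rewrite add0r.
  have [d d0 hd] := sol_uniform0 (inner_lifetime it) e0.
  have [s [[si us] ts]] := Bt _ (nbhsx_ballx t d d0).
  have := hd s (inner_lifetime si); rewrite distrC => /(_ ts x).
  by rewrite us sub0r normrN.
have zi t : inner t -> forall x, u t x = 0.
  by move=> it; have [] : B t by rewrite BA.
move=> t x tT; case: (tT) => + tT'; rewrite le_eqVlt => /predU1P[t00|tpos]; last exact: zi.
(* The remaining time 0 is a limit of positive times; taking [s] at most [t0] keeps it within the
   lifespan. *)
apply/eqP; rewrite -normr_le0; apply/ler_addgt0Pr => e e0; rewrite add0r.
have [d d0 hd] := sol_uniform0 tT e0.
case: (it0) => t0pos t0T.
pose s := Num.min t0 (d / 2).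
have s0 : 0 < s by rewrite lt_min t0pos divr_gt0.
have si : inner s.
  by split=> //; apply: le_lt_trans t0T; rewrite lee_fin ge_min lexx.
have := hd s (inner_lifetime si); rewrite -t00 subr0 gtr0_norm// => /(_ _ x).
rewrite zi// sub0r normrN; apply.
by rewrite gt_min; apply/orP; right; lra.
Qed.

Lemma zero_on_rectangle t d a b : inner t -> 0 < d -> a < b ->
  (forall s x, `|s - t| < d -> a < x < b -> u s x = 0) ->
  forall s x, lifetime T s -> u s x = 0.
Proof. by move=> it d0 ab /(vanishing_at it d0 ab); exact: zero_everywhere. Qed.

(** * A common support on a time interval *)

Lemma inner_segment : exists a b, a < b /\ forall t, a <= t <= b -> inner t.
Proof.
have [t it] : exists t, inner t.
  case: sol => + _ _ _ _; case: T => [r| |//].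
    rewrite lte_fin => r0; exists (r / 2); split; first by rewrite divr_gt0.
    by rewrite lte_fin; lra.
  by exists 1; split=> //; rewrite ltry.
have [d d0 hd] := inner_ball it.
exists (t - d), (t + d); split; first by lra.
by move=> s /andP[? ?]; apply: hd; rewrite ler_norml; apply/andP; split; lra.
Qed.

(* Baire: the closed sets of times at which [u t] is supported in [[-n, n]]
   cover a segment, so one of them contains an interval. *)
Lemma common_support : (forall t, inner t -> has_compact_support (u t)) ->
  exists t d n, [/\ inner t, 0 < d &
    forall s x, `|s - t| < d -> n < `|x| -> u s x = 0].
Proof.
move=> cs; have [a [b [ab abi]]] := inner_segment.
(* Complements of the closed sets. The implication puts every time outside [[a, b]] into [O n], so
   Baire's theorem can be used on the whole line, and an open set missing [O n] lies in [[a, b]]. *)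
pose O (n : nat) : set R := [set t | a <= t <= b ->
  exists x, n%:R < `|x| /\ u t x != 0].
have oO n : open (O n).
  rewrite openE => t Ot.
  have [tab|] := boolP (a <= t <= b); last first.
    rewrite negb_and -!ltNge => /orP[ta|bt].
      near=> s => /andP[as_ _]; exfalso; move: as_; apply/negP; rewrite -ltNge.
      by near: s; exact: lt_nbhsl.
    near=> s => /andP[_ sb]; exfalso; move: sb; apply/negP; rewrite -ltNge.
    by near: s; exact: lt_nbhsr.
  have [x [nx ux]] := Ot tab; have it := abi _ tab.
  have e0 : 0 < `|u t x| / 2 by rewrite divr_gt0// normr_gt0.
  have [d d0 hd] := sol_uniform0 (inner_lifetime it) e0.
  apply/nbhs_ballP; exists d => // s; rewrite /ball/= distrC => st sab.
  exists x; split=> //; apply/eqP => us.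
  have := hd s (inner_lifetime (abi _ sab)) st x.
  by rewrite us sub0r normrN; move: e0; lra.
have [dO|] := pselect (forall n, dense (O n)); last first.
  move=> /existsNP[n ndO]; have [V [V0 oV VO]] : exists V : set R,
      [/\ V !=set0, open V & V `&` O n = set0].
    apply: contrapT => h; apply: ndO => V V0 oV; apply/set0P/eqP => VO.
    by apply: h; exists V.
  have [t Vt] := V0.
  have tO s : V s -> a <= s <= b /\ forall x, n%:R < `|x| -> u s x = 0.
    move=> Vs; have nOs : ~ O n s.
      by move=> Os; have : (V `&` O n) s by []; rewrite VO.
    split; first by apply: contrapT => sab; apply: nOs => /sab.
    move=> x nx; apply/eqP; apply: contrapT => /negP ux; apply: nOs => _.
    by exists x.
  have /nbhs_ballP[d /= d0 hd] : nbhs t V by exact: open_nbhs_nbhs.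
  exists t, d, n%:R; split=> //; first by apply: abi; exact: (tO t Vt).1.
  move=> s x st nx; apply: (tO s _).2 => //; apply: hd; by rewrite /ball/= distrC.
(* If all [O n] were dense, some time in []a, b[] would lie in every [O n], that is, have unbounded
   support. *)
have /(_ `]a, b[%classic) [||t [tab Ot]] := @Baire R R O (fun n => conj (oO n) (dO n)).
- by exists ((a + b) / 2); rewrite /= in_itv/=; apply/andP; split; lra.
- exact: interval_open.
exfalso; move: tab; rewrite /= in_itv/= => /andP[/ltW at_ /ltW tb].
have tab : a <= t <= b by rewrite at_.
have [N N0 uN] := has_compact_support_bounded (cs _ (abi _ tab)).
have [x [nx /eqP]] := Ot (Num.bound N) I tab; apply.
apply: uN; apply: le_lt_trans nx; apply: ltW.
by apply: le_lt_trans (archi_boundP (ltW N0)).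
Unshelve. all: by end_near. Qed.

End dgh.

(** * The equivalence of the three statements *)

Lemma L2_eventually_cst (R : realType) (f : R -> R) (N c : R) :
  L2 f -> (forall x, N < x -> f x = c) -> c = 0.
Proof.
move=> Lf fc; apply/eqP/negP => /negP c0.
have int2 := Lfun2_integrable_sqr Lf.
have mf2 := measurable_int _ int2.
pose I := fine (\int[@lebesgue_measure R]_x (f x ^+ 2)%:E)%E.
have IE : (\int[@lebesgue_measure R]_x (f x ^+ 2)%:E)%E = I%:E.
  by rewrite /I fineK//; exact: integrable_fin_num int2.
have I0 : 0 <= I by apply: fine_ge0; apply: integral_ge0 => x _; rewrite lee_fin sqr_ge0.
have c2 : 0 < c ^+ 2 by rewrite exprn_even_gt0.
(* On an interval of this length [c^2] integrates to [I + c^2], more than the whole integral of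
   [f^2]. *)
pose L := I / c ^+ 2 + 1; have L0 : 0 < L by rewrite ltr_wpDl// divr_ge0// ltW.
have : ((c ^+ 2 * L)%:E <= I%:E)%E.
  rewrite -IE; have -> : (c ^+ 2 * L)%:E =
      (\int[@lebesgue_measure R]_(x in `[(N + 1)%R, (N + 1 + L)%R]) (f x ^+ 2)%:E)%E.
    transitivity (\int[@lebesgue_measure R]_(x in `[(N + 1)%R, (N + 1 + L)%R])
        (cst (c ^+ 2)%:E) x)%E.
      have := @lebesgue_measure_itv R `[(N + 1), (N + 1 + L)].
      rewrite /= lte_fin ltrDl L0 -EFinD (addrAC (N + 1)) subrr add0r => m1.
      by rewrite integral_cst// [X in (_ * X)%E]m1 EFinM.
    apply: eq_integral => x; rewrite inE/= in_itv/= => /andP[Nx _].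
    by rewrite fc//; lra.
  apply: ge0_subset_integral => // x _.
  by rewrite lee_fin sqr_ge0.
rewrite lee_fin /L mulrDr mulrCA divff ?gt_eqF// !mulr1; lra.
Qed.

Theorem theorem2p2 (R : realType) (omega gamma : R) (u0 : R -> R) (T : \bar R)
    (u : R -> R -> R) (hu0 : sobolev 4 u0)
    (hu : dgh_maximal_solution omega gamma u0 T u) :
  let S1 := forall t : R, lifetime T t ->
    has_compact_support (fun x => u t x + omega + gamma / 2) in
  let S2 := (forall t x : R, lifetime T t -> u t x = 0) /\ omega + gamma / 2 = 0 in
  let S3 := (exists Omega : set (R * R),
      [/\ Omega !=set0, open Omega,
          (forall t x : R, Omega (t, x) -> lifetime T t)
        & forall t x : R, Omega (t, x) -> u t x = 0])
    /\ omega + gamma / 2 = 0 in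
  (S1 <-> S2) /\ (S2 <-> S3).
Proof.
move=> S1 S2 S3; case: hu => sol _.
have lt0 : lifetime T 0 by case: sol => T0 _ _ _ _; split.
split; split.
(* Time 0 suffices here: [u 0] equals [- (omega + gamma / 2)] far out and is square integrable. *)
- move=> s1; have c0 : omega + gamma / 2 = 0.
    have [N N0 uN] := has_compact_support_bounded (s1 0 lt0).
    apply/eqP; rewrite -oppr_eq0; apply/eqP.
    apply: (@L2_eventually_cst _ (u 0) N); first by have [] := sol_sobolev sol lt0.
    move=> x Nx; have : u 0 x + omega + gamma / 2 = 0.
      by apply: uN; exact: lt_le_trans (ler_norm _).
    by rewrite -addrA => /eqP; rewrite addr_eq0 => /eqP.
  split=> // t x tT.
  have [|s [d [n [si d0 un]]]] := common_support sol.
    move=> s si; have := s1 s (inner_lifetime si).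
    by congr has_compact_support; apply/funext => z; rewrite -addrA c0 addr0.
  (* Any interval to the right of the common support will do. *)
  have ab : `|n| + 1 < `|n| + 2 by lra.
  apply: (zero_on_rectangle sol c0 si d0 ab _ _ tT) => s' x' ss' /andP[nx _].
  apply: un => //; apply: lt_le_trans (ler_norm _).
  by have := ler_norm n; lra.
- move=> [uz c0] t tT; apply: (@has_compact_support_itv _ _ 0 0) => x _.
  by rewrite uz// add0r.
- move=> [uz c0]; split=> //.
  have [a [b [ab abi]]] := inner_segment sol.
  exists (fst @^-1` `]a, b[%classic); split.
  + exists ((a + b) / 2, 0); rewrite /= in_itv/=; apply/andP; split; lra.
  + by apply: open_comp; [move=> p _; exact: cvg_fst|exact: interval_open].
  + move=> t x /=; rewrite in_itv/= => /andP[at_ tb].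
    by apply: inner_lifetime; apply: abi; rewrite !ltW.
  + move=> t x /=; rewrite in_itv/= => /andP[at_ tb].
    by apply: uz; apply: inner_lifetime; apply: abi; rewrite !ltW.
- move=> [[Om [[[t0 x0] Om0] oOm OmT Omu]] c0]; split=> // t x tT.
  have /nbhs_ballP[r /= r0 hr] : nbhs (t0, x0) Om by exact: open_nbhs_nbhs.
  have hrect s y : `|s - t0| < r -> `|y - x0| < r -> Om (s, y).
    by move=> st yx; apply: hr; split; rewrite /ball/= distrC.
  (* [Om] is open in the plane, so it also contains times before [t0]; these are nonnegative, which
     excludes [t0 = 0]. *)
  have it0 : 0 < t0 /\ (t0%:E < T)%E.
    have [_ tT0] := OmT _ _ Om0; split=> //.
    have [] : lifetime T (t0 - r / 2).
      apply: (OmT _ x0); apply: hrect; last by rewrite subrr normr0.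
      by rewrite addrAC subrr add0r normrN gtr0_norm ?divr_gt0//; lra.
    by lra.
  have ab : x0 - r < x0 + r by lra.
  apply: (zero_on_rectangle sol c0 it0 r0 ab _ _ tT) => s y st /andP[xy yx].
  by apply: Omu; apply: hrect => //; rewrite ltr_norml; apply/andP; split; lra.
Qed.
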